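(* Let $\pi$ be a real representation of $\mathrm{GL}_n(\mathbb{F}_q)$, where $q$ is odd, and put $m_\pi=\frac{\dim\pi-\chi_\pi(h_1)}{2}$. Then $$w_2(\pi)=\begin{cases}\dfrac{m_\pi}{2}\,a_2,&\text{if }q\equiv1\pmod4,\\[2mm] \dbinom{m_\pi}{2}\left(\sum\limits_{i=1}^n v_i^2\right),&\text{if }q\equiv3\pmod4.\end{cases}$$
   Context: A real representation is a finite-dimensional representation on a real vector space; $\chi_\pi$ is its character. $h_1=\mathrm{diag}(-1,1,\dots,1)$. Cohomology is with $\mathbb{Z}/2\mathbb{Z}$ coefficients, and $w_2$ is the second Stiefel-Whitney class. Let $D$ be the diagonal subgroup of $\mathrm{GL}_n(\mathbb{F}_q)$, identified with $C_{q-1}^n$ by fixing a generator of $\mathbb{F}_q^\times$, and let $C_2^n=\{\mathrm{diag}(\pm1,\dots,\pm1)\}$. The restriction $H^*(\mathrm{GL}_n(\mathbb{F}_q))\to H^*(D)$ is injective when $q\equiv1\pmod4$, and $H^*(\mathrm{GL}_n(\mathbb{F}_q))\to H^*(C_2^n)$ is injective when $q\equiv3\pmod4$; classes of $\mathrm{GL}_n(\mathbb{F}_q)$ are identified with their images in $H^*(D)$, resp. $H^*(C_2^n)$, so the two formulas are for $w_2(\pi|_D)$ and $w_2(\pi|_{C_2^n})$ respectively. If $q\equiv1\pmod4$: $a_2=\sum_{i=1}^n t_i$, where $t_i\in H^2(D)$ is the second Stiefel-Whitney class of the underlying real representation of the complex linear character of $D\cong C_{q-1}^n$ that sends the generator of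 the $i$-th factor to a fixed primitive $(q-1)$-th root of unity and is trivial on the other factors; in this case $m_\pi$ is even. If $q\equiv3\pmod4$: $v_i\in H^1(C_2^n)$ is the first Stiefel-Whitney class of the character $\mathrm{diag}(\epsilon_1,\dots,\epsilon_n)\mapsto\epsilon_i$, and $H^*(C_2^n)=(\mathbb{Z}/2\mathbb{Z})[v_1,\dots,v_n]$. *)

(* Defs.v *)
From HB Require Import structures.
From mathcomp Require Import all_boot all_order all_algebra all_fingroup.
From mathcomp Require Import all_solvable all_field all_character.
From mathcomp Require Import generic_quotient ring_quotient.
From mathcomp Require Import reals zify ring.
From mathcomp.real_closed Require Import complex.

Set Implicit Arguments.
Unset Strict Implicit.
Unset Printing Implicit Defensive.

Import GRing.Theory.
Local Open Scope ring_scope.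
Local Open Scope quotient_scope.

(* H^k(G; Z/2) is computed with the inhomogeneous bar complex.  The coefficients
   are F_2 with trivial action, so the signs of the coboundary are omitted. *)

Notation cochain gT k := {ffun k.-tuple gT -> 'F_2}.

Section Cochains.
Variable gT : finGroupType.
Implicit Types (s : seq gT) (i j k m : nat).

(* Evaluation at a list of the right length; 0 at any other list. *)
Definition cochain_at k (f : cochain gT k) s : 'F_2 :=
  if insub s is Some t then f t else 0.

Lemma cochain_atE k (f : cochain gT k) (t : k.-tuple gT) :
  cochain_at f t = f t.
Proof. by rewrite /cochain_at valK. Qed.

Lemma cochain_at_size k (f : cochain gT k) s (sz_s : size s == k) :
  cochain_at f s = f (Tuple sz_s).
Proof. by rewrite -cochain_atE. Qed.

Lemma cochain_at0 k s : cochain_at (0 : cochain gT k) s = 0.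
Proof. by rewrite /cochain_at; case: insub => // t; rewrite ffunE. Qed.

Lemma cochain_atB k (f g : cochain gT k) s :
  cochain_at (f - g) s = cochain_at f s - cochain_at g s.
Proof.
by rewrite /cochain_at; case: insub => [t|]; rewrite ?subr0 // !ffunE.
Qed.

(* (g_0, .., g_i, g_(i+1), ..) |-> (g_0, .., g_i * g_(i+1), ..) *)
Definition contract i s : seq gT :=
  take i s ++ (nth 1 s i * nth 1 s i.+1)%g :: drop i.+2 s.

Definition coboundary_at k (f : cochain gT k) s : 'F_2 :=
  cochain_at f (behead s)
  + \sum_(0 <= i < k) cochain_at f (contract i s)
  + cochain_at f (take k s).

Definition coboundary k (f : cochain gT k) : cochain gT k.+1 :=
  [ffun t : k.+1.-tuple gT => coboundary_at f t].

Lemma size_contract k i s : size s = k.+1 -> (i < k)%N ->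
  size (contract i s) = k.
Proof.
move=> sz_s lt_ik; rewrite size_cat /= size_drop size_take sz_s.
by rewrite (ltn_trans lt_ik) // subSS; lia.
Qed.

Lemma coboundary_atE k (f : cochain gT k) s : size s = k.+1 ->
  cochain_at (coboundary f) s = coboundary_at f s.
Proof. by move/eqP=> sz_s; rewrite (cochain_at_size _ sz_s) ffunE. Qed.

Lemma coboundary0 k : coboundary (0 : cochain gT k) = 0.
Proof.
apply/ffunP=> t; rewrite !ffunE /coboundary_at !cochain_at0 add0r addr0.
by apply: big1 => i _; rewrite cochain_at0.
Qed.

Lemma coboundaryB k (f g : cochain gT k) :
  coboundary (f - g) = coboundary f - coboundary g.
Proof.
apply/ffunP=> t; rewrite !ffunE /coboundary_at !cochain_atB.
under eq_bigr do rewrite cochain_atB.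
by rewrite sumrB; ring.
Qed.

Definition cup_cochain i j k (e : (i + j)%N = k)
    (a : cochain gT i) (b : cochain gT j) : cochain gT k :=
  [ffun t : k.-tuple gT =>
    cochain_at a (take i t) * cochain_at b (drop i t)].

Lemma cup_cochain_at i j k (e : (i + j)%N = k) a b s : size s = k ->
  cochain_at (cup_cochain e a b) s
    = cochain_at a (take i s) * cochain_at b (drop i s).
Proof. by move/eqP=> sz_s; rewrite (cochain_at_size _ sz_s) ffunE. Qed.

Lemma cup_cochainBl i j k (e : (i + j)%N = k) a a' b :
  cup_cochain e a' b - cup_cochain e a b = cup_cochain e (a' - a) b.
Proof. by apply/ffunP=> t; rewrite !ffunE cochain_atB mulrBl. Qed.

Lemma cup_cochainBr i j k (e : (i + j)%N = k) a b b' :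
  cup_cochain e a b' - cup_cochain e a b = cup_cochain e a (b' - b).
Proof. by apply/ffunP=> t; rewrite !ffunE cochain_atB mulrBr. Qed.

Lemma addrr_F2 (x : 'F_2) : x + x = 0.
Proof. by case: x => [[|[|]]] // lt2; apply/val_inj. Qed.

Lemma oppr_F2 (x : 'F_2) : - x = x.
Proof. by apply/eqP; rewrite eq_sym -addr_eq0 addrr_F2. Qed.

(* The Leibniz rule d(a b) = da b + a db. *)
Lemma coboundary_cup i j k (e : (i + j)%N = k)
    (e1 : (i.+1 + j)%N = k.+1) (e2 : (i + j.+1)%N = k.+1) a b :
  coboundary (cup_cochain e a b)
    = cup_cochain e1 (coboundary a) b + cup_cochain e2 a (coboundary b).
Proof.
apply/ffunP=> t; rewrite !ffunE /coboundary_at.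
have sz_t : size t = (i + j).+1 by rewrite size_tuple -e.
have le_i : (i <= i + j)%N by rewrite leq_addr.
rewrite !coboundary_atE; first last.
- by rewrite size_takel // sz_t ltnS.
- by rewrite size_drop sz_t -addnS addKn.
subst k; rewrite !cup_cochain_at; first last.
- by rewrite size_behead sz_t.
- by rewrite size_takel // sz_t.
rewrite (@big_cat_nat _ _ _ i) //=.
have -> : \sum_(0 <= m < i) cochain_at (cup_cochain erefl a b) (contract m t)
  = (\sum_(0 <= m < i) cochain_at a (contract m (take i.+1 t)))
      * cochain_at b (drop i.+1 t).
  rewrite big_distrl /=; apply: eq_big_nat => m /andP[_ lt_mi].
  have lt_mk := leq_trans lt_mi le_i.
  rewrite cup_cochain_at ?(size_contract sz_t) //.
  have sz1 : size (take m t) = m.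
    by rewrite size_takel // sz_t ltnW // ltnS ltnW.
  congr (_ * _); [congr (cochain_at a _)|congr (cochain_at b _)].
  - rewrite /contract take_cat sz1 ltnNge (ltnW lt_mi) /=.
    rewrite take_takel ?(leq_trans (ltnW lt_mi)) //.
    rewrite !nth_take ?ltnS // 1?ltnW //.
    have -> : (i - m = (i - m.+1).+1)%N by rewrite -subSn // subSS.
    by rewrite /= take_drop; congr (_ ++ _ :: drop _ (take _ _)); lia.
  - rewrite /contract drop_cat sz1 ltnNge (ltnW lt_mi) /=.
    have -> : (i - m = (i - m.+1).+1)%N by rewrite -subSn // subSS.
    rewrite /= drop_drop; congr (drop _ t); lia.
have -> : \sum_(i <= m < i + j)
      cochain_at (cup_cochain erefl a b) (contract m t)
  = cochain_at a (take i t)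
      * (\sum_(0 <= m < j) cochain_at b (contract m (drop i t))).
  rewrite -{1}(add0n i) big_addn addKn big_distrr /=.
  apply: eq_big_nat => m /andP[_ lt_mj].
  have lt_mk : (m + i < i + j)%N by rewrite addnC ltn_add2l.
  rewrite cup_cochain_at ?(size_contract sz_t) //.
  have sz1 : size (take (m + i) t) = (m + i)%N.
    by rewrite size_takel // sz_t ltnW // ltnS ltnW.
  congr (_ * _); [congr (cochain_at a _)|congr (cochain_at b _)].
  - rewrite /contract takel_cat ?sz1 ?leq_addl //.
    by rewrite take_takel ?leq_addl.
  - rewrite /contract drop_cat sz1 !nth_drop drop_drop !addSn ![(i + m)%N]addnC.
    rewrite addnS [(i + m)%N]addnC take_drop.
    case: ltnP => [//|le_mi]; have m0 : m = 0 by lia.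
    rewrite m0 add0n subnn drop0 [drop i (take _ _)]drop_oversize //.
    by rewrite size_take_min geq_minl.
have -> : take i (behead t) = behead (take i.+1 t).
  by rewrite -!drop1 take_drop addn1.
have -> : drop i (behead t) = drop i.+1 t by rewrite -drop1 drop_drop addn1.
have -> : take i (take (i + j) t) = take i t by rewrite take_takel.
have -> : drop i (take (i + j) t) = take j (drop i t).
  by rewrite take_drop; congr (drop _ (take _ _)); lia.
rewrite /coboundary_at take_takel // -!drop1 !drop_drop add1n.
have := addrr_F2 (cochain_at a (take i t) * cochain_at b (drop i.+1 t)).
set x := cochain_at a (take i t); set y := cochain_at b (drop i.+1 t).
set u := cochain_at a (drop 1 _); set v := cochain_at b (take j _).
set S1 := \sum_(0 <= m < i) _; set S2 := \sum_(0 <= m < j) _ => xy.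
by rewrite -[LHS]addr0 -xy; ring.
Qed.

Lemma coboundary_cocycle_cup i j k (e : (i + j)%N = k) a b :
  coboundary a = 0 -> coboundary b = 0 -> coboundary (cup_cochain e a b) = 0.
Proof.
move=> da0 db0.
have e1 : (i.+1 + j)%N = k.+1 by rewrite addSn e.
have e2 : (i + j.+1)%N = k.+1 by rewrite addnS e.
rewrite (coboundary_cup e e1 e2) da0 db0; apply/ffunP=> t.
by rewrite !ffunE !cochain_at0 mul0r mulr0 addr0.
Qed.

Definition is_cocycle k : {pred cochain gT k} := fun f => coboundary f == 0.

Fact is_cocycle_zmod k : zmod_closed (@is_cocycle k).
Proof.
split=> [|f g]; rewrite /in_mem /= /is_cocycle ?coboundary0 //.
by rewrite coboundaryB => /eqP-> /eqP->; rewrite subr0.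
Qed.

HB.instance Definition _ k :=
  GRing.isZmodClosed.Build (cochain gT k) (@is_cocycle k) (@is_cocycle_zmod k).

Record cocycle k := Cocycle {
  cocycle_val :> cochain gT k;
  cocycleP : cocycle_val \in @is_cocycle k }.

HB.instance Definition _ k := [isSub for @cocycle_val k].
HB.instance Definition _ k := [Choice of cocycle k by <:].
HB.instance Definition _ k := [SubChoice_isSubZmodule of cocycle k by <:].

Definition is_coboundary k : {pred cocycle k} :=
  match k with
  | 0 => fun f => f == 0
  | k'.+1 => fun f => [exists g : cochain gT k', val f == coboundary g]
  end.

Fact is_coboundary_zmod k : zmod_closed (@is_coboundary k).
Proof.
case: k => [|k]; split=> [|f g].
- exact: eqxx.
- by move=> /eqP-> /eqP->; rewrite subr0; exact: eqxx.
- by apply/existsP; exists 0; rewrite coboundary0.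
- case/existsP=> a /eqP fE /existsP[b /eqP gE]; apply/existsP; exists (a - b).
  by rewrite raddfB /= fE gE coboundaryB.
Qed.

HB.instance Definition _ k :=
  GRing.isZmodClosed.Build (cocycle k) (@is_coboundary k)
    (@is_coboundary_zmod k).

Definition cohom k := {ideal_quot (@is_coboundary k)}.

Fact cup_subproof i j k (e : (i + j)%N = k) (a : cocycle i) (b : cocycle j) :
  cup_cochain e a b \in @is_cocycle k.
Proof.
by apply/eqP/coboundary_cocycle_cup; apply/eqP; [exact: (cocycleP a)
                                               | exact: (cocycleP b)].
Qed.

Definition cup_cocycle i j k (e : (i + j)%N = k) (a : cocycle i)
  (b : cocycle j) : cocycle k := Cocycle (cup_subproof e a b).

Definition cohom_class k (c : cocycle k) : cohom k := \pi_(cohom k) c.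

Lemma cohom_classP k (c c' : cocycle k) :
  reflect (cohom_class c = cohom_class c') (c - c' \in @is_coboundary k).
Proof. by rewrite Quotient.idealrBE; exact: eqP. Qed.

Lemma cohom_classB k : {morph @cohom_class k : c c' / c - c'}.
Proof. exact: raddfB. Qed.

Definition cup i j k (e : (i + j)%N = k) (x : cohom i) (y : cohom j)
  : cohom k := cohom_class (cup_cocycle e (repr x) (repr y)).

Lemma cup_class i j k (e : (i + j)%N = k) (a : cocycle i) (b : cocycle j) :
  cup e (cohom_class a) (cohom_class b) = cohom_class (cup_cocycle e a b).
Proof.
rewrite /cup.
have : cohom_class (repr (cohom_class a)) = cohom_class a by exact: reprK.
have : cohom_class (repr (cohom_class b)) = cohom_class b by exact: reprK.
move: (repr (cohom_class a)) (repr (cohom_class b)) => a' b'.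
move=> /cohom_classP cob_b /cohom_classP cob_a.
apply: (@etrans _ _ (cohom_class (cup_cocycle e a b'))); apply/cohom_classP.
- case: i => [|i] in e a a' cob_a *.
    by move/eqP/subr0_eq: cob_a => ->; rewrite subrr; exact: rpred0.
  case: k e => [//|k] e; have e' : (i + j)%N = k by case: e.
  case/existsP: cob_a => g /eqP /= gE.
  apply/existsP; exists (cup_cochain e' g b').
  have e2 : (i + j.+1)%N = k.+1 by rewrite addnS e'.
  rewrite /= cup_cochainBl gE (coboundary_cup e' e e2) (eqP (cocycleP b')).
  by apply/eqP/ffunP=> t; rewrite !ffunE cochain_at0 mulr0 addr0.
- case: j => [|j] in e b b' cob_b *.
    by move/eqP/subr0_eq: cob_b => ->; rewrite subrr; exact: rpred0.
  case: k e => [|k] e; first by exfalso; rewrite addnS in e.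
  have e' : (i + j)%N = k by move: e; rewrite addnS => -[].
  case/existsP: cob_b => g /eqP /= gE.
  apply/existsP; exists (cup_cochain e' a g).
  have e1 : (i.+1 + j)%N = k.+1 by rewrite addSn e'.
  rewrite /= cup_cochainBr gE (coboundary_cup e' e1 e) (eqP (cocycleP a)).
  by apply/eqP/ffunP=> t; rewrite !ffunE cochain_at0 mul0r add0r.
Qed.

Fact cohom1_subproof : ([ffun=> 1] : cochain gT 0) \in @is_cocycle 0.
Proof.
apply/eqP/ffunP=> t; rewrite !ffunE /coboundary_at big_geq // addr0.
have sz0 (s : seq gT) : size s = 0 -> cochain_at ([ffun=> 1] : cochain gT 0) s = 1.
  by move/eqP=> sz_s; rewrite (cochain_at_size _ sz_s) ffunE.
by rewrite !sz0 ?addrr_F2 ?take0 // size_behead size_tuple.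
Qed.

Definition cohom1 : cohom 0 := cohom_class (Cocycle cohom1_subproof).

End Cochains.

Section Functoriality.
Variables (gT hT : finGroupType) (f : {morphism [set: hT] >-> gT}).

Definition pull_cochain k (c : cochain gT k) : cochain hT k :=
  [ffun t : k.-tuple hT => c [tuple of map f t]].

Lemma pull_cochain_at k (c : cochain gT k) s : size s = k ->
  cochain_at (pull_cochain c) s = cochain_at c (map f s).
Proof.
move/eqP=> sz_s; rewrite (cochain_at_size _ sz_s) ffunE -cochain_atE /=.
by congr (cochain_at c _).
Qed.

Lemma map_contract i s : (i.+1 < size s)%N ->
  map f (contract i s) = contract i (map f s).
Proof.
move=> lt_is; rewrite /contract map_cat map_take /= map_drop morphM ?inE //.
by rewrite !(nth_map 1%g) // ltnW.
Qed.

Lemma coboundary_pull k (c : cochain gT k) :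
  coboundary (pull_cochain c) = pull_cochain (coboundary c).
Proof.
apply/ffunP=> t; rewrite !ffunE /coboundary_at /=.
have sz_t := size_tuple t.
rewrite !pull_cochain_at ?size_behead ?size_takel ?sz_t //.
congr (_ + _ + _); last by rewrite map_take.
- by rewrite behead_map.
apply: eq_big_nat => i /andP[_ lt_ik].
by rewrite pull_cochain_at ?(size_contract sz_t) // map_contract // sz_t.
Qed.

Fact pull_subproof k (c : cocycle gT k) : pull_cochain c \in @is_cocycle hT k.
Proof.
apply/eqP; rewrite coboundary_pull (eqP (cocycleP c)).
by apply/ffunP=> t; rewrite !ffunE.
Qed.

Definition pull_cocycle k (c : cocycle gT k) : cocycle hT k :=
  Cocycle (pull_subproof c).

Definition pull k (x : cohom gT k) : cohom hT k :=
  cohom_class (pull_cocycle (repr x)).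

Lemma pull_class k (c : cocycle gT k) :
  pull (cohom_class c) = cohom_class (pull_cocycle c).
Proof.
rewrite /pull.
have : cohom_class (repr (cohom_class c)) = cohom_class c by exact: reprK.
move: (repr _) => c' /cohom_classP cob_c; apply/cohom_classP.
case: k => [|k] in c c' cob_c *.
  by move/eqP/subr0_eq: cob_c => ->; rewrite subrr; exact: rpred0.
case/existsP: cob_c => g /eqP /= gE; apply/existsP; exists (pull_cochain g).
by rewrite coboundary_pull -gE; apply/eqP/ffunP=> t; rewrite !ffunE.
Qed.
End Functoriality.

Section PullRepr.
Variables (R : fieldType) (gT hT : finGroupType).
Variables (f : {morphism [set: hT] >-> gT}) (rho : representation R [set: gT]).

Fact pull_mx_repr : mx_repr [set: hT] (fun x => rho (f x)).
Proof.
split=> [|x y _ _]; first by rewrite morph1 repr_mx1.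
by rewrite morphM ?inE // repr_mxM ?inE.
Qed.

Definition pull_repr : representation R [set: hT] :=
  Representation (MxRepresentation pull_mx_repr).
End PullRepr.

Definition res_repr (R : fieldType) (gT : finGroupType)
    (rho : representation R [set: gT]) (H : {group gT}) :
    representation R [set: subg_of H] :=
  pull_repr [morphism of @sgval gT H] rho.

(* The Stiefel-Whitney classes of real representations, i.e. of the associated
   flat vector bundles on BG, given by the usual axioms.  The representation in
   sw_normalized is the sign representation of a group of order 2, whose bundle
   is the tautological line bundle on the infinite real projective space. *)

Record SW_theory (R : realType) := SWTheory {
  sw : forall gT : finGroupType,
    representation R [set: gT] -> forall k, cohom gT k;
  sw_iso : forall (gT : finGroupType) (rho sigma : representation R [set: gT]),
    mx_rsim rho sigma -> forall k, sw rho k = sw sigma k;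
  sw_zero : forall (gT : finGroupType) (rho : representation R [set: gT]),
    sw rho 0%N = cohom1 gT;
  sw_rank : forall (gT : finGroupType) (rho : representation R [set: gT]) k,
    (rdegree rho < k)%N -> sw rho k = 0;
  sw_natural : forall (gT hT : finGroupType)
      (f : {morphism [set: hT] >-> gT}) (rho : representation R [set: gT]) k,
    sw (pull_repr f rho) k = pull f (sw rho k);
  sw_whitney : forall (gT : finGroupType)
      (rho sigma : representation R [set: gT]) k,
    sw (dadd_grepr rho sigma) k =
      \sum_(i < k.+1) cup (subnKC (leq_ord i)) (sw rho i) (sw sigma (k - i)%N);
  sw_normalized : forall (gT : finGroupType)
      (rho : representation R [set: gT]),
    #|gT| = 2%N -> rdegree rho = 1%N -> (exists x, rho x != 1%:M) ->
    sw rho 1%N != 0 }.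

Section RealOfChar.
Variables (R : realType) (gT : finGroupType) (chi : gT -> R[i]).
Hypotheses (chi1 : chi 1%g = 1) (chiM : {morph chi : x y / (x * y)%g >-> x * y}).

(* Right multiplication of row vectors by this matrix is multiplication by z in
   the basis (1, i) of C. *)
Definition real_mx (z : R[i]) : 'M[R]_(1 + 1) :=
  block_mx (complex.Re z)%:M (complex.Im z)%:M
           (- complex.Im z)%:M (complex.Re z)%:M.

Lemma real_mx1 : real_mx 1 = 1%:M.
Proof. by rewrite /real_mx /= oppr0 scalar_mx_block !raddf0. Qed.

Lemma real_mxM z t : real_mx (z * t) = real_mx z *m real_mx t.
Proof.
case: z t => [a b] [c d]; rewrite /real_mx mulmx_block /= -!scalar_mxM.
by rewrite -!raddfD /=; congr block_mx; congr (_%:M); ring.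
Qed.

Fact real_of_char_repr : mx_repr [set: gT] (fun x => real_mx (chi x)).
Proof. by split=> [|x y _ _]; rewrite ?chi1 ?real_mx1 // chiM real_mxM. Qed.

Definition real_of_char : representation R [set: gT] :=
  Representation (MxRepresentation real_of_char_repr).
End RealOfChar.

Section DiagGL.
Variables (F : finFieldType) (n : nat).
Implicit Types A B : {'GL_n.+1[F]}.

Fact h1_subproof :
  diag_mx (\row_(j < n.+1) if j == 0 then - 1 else 1 : F) \is a GRing.unit.
Proof.
rewrite -[_ \is a _]/(_ \in unitmx) unitmxE det_diag unitfE.
by apply/prodf_neq0 => j _; rewrite mxE; case: ifP; rewrite ?oppr_eq0 oner_eq0.
Qed.

Definition h1 : {'GL_n.+1[F]} := FinRing.Unit h1_subproof.

Definition diagGL : {set {'GL_n.+1[F]}} := [set A | is_diag_mx (GLval A)].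

Definition signGL : {set {'GL_n.+1[F]}} :=
  [set A in diagGL | [forall i, (GLval A i i == 1) || (GLval A i i == - 1)]].

Lemma diagGLM A B i : A \in diagGL ->
  GLval (A * B)%g i i = GLval A i i * GLval B i i.
Proof.
rewrite inE => /is_diag_mxP dA; rewrite GL_ME -[_ * _]/(_ *m _) mxE (bigD1 i) //=.
rewrite big1 ?addr0 // => j ne_ji; rewrite dA ?mul0r //.
by rewrite eq_sym (inj_eq val_inj).
Qed.

Lemma diagGL_neq0 A i : A \in diagGL -> GLval A i i != 0.
Proof.
move=> dA; have := diagGLM A^-1 i dA.
rewrite mulgV GL_1E mxE eqxx => /esym AA1; apply/eqP=> A0.
by move/eqP: AA1; rewrite A0 mul0r eq_sym oner_eq0.
Qed.

Fact diagGL_group_set : group_set diagGL.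
Proof.
apply/group_setP; split=> [|A B].
  by rewrite inE GL_1E; exact: scalar_mx_is_diag.
rewrite !inE => /is_diag_mxP dA /is_diag_mxP dB; apply/is_diag_mxP=> i j ne_ij.
rewrite GL_ME -[_ * _]/(_ *m _) mxE big1 // => k _.
have [<-|ne_ik] := eqVneq i k; first by rewrite dB ?mulr0.
by rewrite dA ?mul0r.
Qed.
Canonical diagGL_group := Group diagGL_group_set.

Fact signGL_group_set : group_set signGL.
Proof.
apply/group_setP; split=> [|A B].
  rewrite inE group1; apply/forallP=> i.
  by rewrite GL_1E mxE eqxx eqxx.
rewrite inE => /andP[dA /forallP sA]; rewrite inE => /andP[dB /forallP sB].
rewrite inE groupM //; apply/forallP=> i; rewrite diagGLM //.
by case/orP: (sA i) => /eqP->; case/orP: (sB i) => /eqP->;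
  rewrite ?mulrNN ?mulr1 ?mul1r ?eqxx ?orbT.
Qed.
Canonical signGL_group := Group signGL_group_set.

(* diag(e_1, .., e_N) |-> e_i, with N = n.+1 and e_j = 1 or -1. *)
Section SignChar.
Variables (R : fieldType) (i : 'I_n.+1).

Fact sign_char_repr : mx_repr [set: subg_of signGL_group]
  (fun u => (if GLval (sgval u) i i == 1 then 1 else - 1)%:M : 'M[R]_1).
Proof.
split=> [|u v _ _]; first by rewrite GL_1E mxE eqxx eqxx.
have := subgP u; rewrite inE => /andP[dA /forallP/(_ i) sA].
have := subgP v; rewrite inE => /andP[_ /forallP/(_ i) sB].
rewrite (_ : GLval (sgval (u * v)%g) i i
    = GLval (sgval u) i i * GLval (sgval v) i i);
  last exact: diagGLM.
rewrite -scalar_mxM; congr (_%:M).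
case/orP: sA => /eqP->; rewrite ?eqxx ?mul1r //.
case/orP: sB => /eqP->; rewrite ?eqxx ?mulr1 // mulrNN mulr1 eqxx.
by case: ifP; rewrite ?mulrNN ?mulr1.
Qed.

Definition sign_char : representation R [set: subg_of signGL_group] :=
  Representation (MxRepresentation sign_char_repr).
End SignChar.

(* Discrete logarithm in base g. *)
Definition dlog (g : {unit F}) (x : F) : nat :=
  index x [seq val (g ^+ k)%g | k <- iota 0 #[g]%g].

Lemma dlogK g x : generator [set: {unit F}] g -> x != 0 ->
  val (g ^+ dlog g x)%g = x.
Proof.
move=> /eqP gen_g; rewrite -unitfE => Ux.
have : FinRing.Unit Ux \in <[g]>%g by rewrite -gen_g inE.
case/cyclePmin=> k lt_k xE.
have x_in : x \in [seq val (g ^+ k)%g | k <- iota 0 #[g]%g].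
  by apply/mapP; exists k; rewrite ?mem_iota // -xE.
have lt_log : (dlog g x < #[g]%g)%N.
  by move: x_in; rewrite -index_mem size_map size_iota.
have := nth_index 0 x_in.
by rewrite (nth_map 0%N) ?size_iota // nth_iota.
Qed.

Section TorusChar.
Variables (R : realType) (g : {unit F}) (z : R[i]).
Hypotheses (hg : generator [set: {unit F}] g)
  (hz : (#|F|.-1).-primitive_root z).

(* diag(g ^ a_1, .., g ^ a_N) |-> z ^ a_i, with N = n.+1. *)
Definition torus_char (i : 'I_n.+1) (A : subg_of diagGL_group) : R[i] :=
  z ^+ dlog g (GLval (sgval A) i i).

Lemma expr_dlog k l : (g ^+ k = g ^+ l)%g -> z ^+ k = z ^+ l.
Proof.
have og : #[g]%g = #|F|.-1 by rewrite orderE -(eqP hg) card_finField_unit.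
move/eqP; rewrite eq_expg_mod_order og => /eqP eq_kl.
by rewrite -(prim_expr_mod hz) eq_kl prim_expr_mod.
Qed.

Fact torus_char1 i : torus_char i 1%g = 1.
Proof.
rewrite /torus_char -(expr0 z); apply: expr_dlog; apply/val_inj.
by rewrite dlogK ?GL_1E ?mxE ?eqxx ?oner_eq0.
Qed.

Fact torus_charM i :
  {morph torus_char i : u v / (u * v)%g >-> u * v}.
Proof.
move=> u v; rewrite /torus_char -exprD; apply: expr_dlog; apply/val_inj.
have nz (w : subg_of diagGL_group) : GLval (sgval w) i i != 0.
  by apply: diagGL_neq0; exact: subgP.
rewrite dlogK // expgD [RHS]FinRing.val_unitM !dlogK //; apply: diagGLM.
exact: subgP.
Qed.

Definition torus_repr (i : 'I_n.+1) :
    representation R [set: subg_of diagGL_group] :=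
  real_of_char (torus_char1 i) (torus_charM i).
End TorusChar.
End DiagGL.

(* Main.v *)
Require Import Defs.
From HB Require Import structures.
From mathcomp Require Import all_boot all_order all_algebra all_fingroup.
From mathcomp Require Import all_solvable all_field all_character.
From mathcomp Require Import generic_quotient.
From mathcomp Require Import reals zify ring.
From mathcomp.real_closed Require Import complex.

(** The restriction of w_2(pi) to the diagonal group D, a product of cyclic
   groups of even order, is recognised by the central extension that it
   classifies.  A class x in H^2(D; Z/2) is a central extension of D by Z/2, and
   it splits as soon as lifts of the standard generators h_i commute and satisfy
   the relations of D ([cohom2_eq0]).  Thus x is zero if and only if two kinds of
   numbers in Z/2 vanish: the commutators of the lifts of h_i and h_j
   ([commutator_form]), and the powers of the lifts of h_i by the order of h_i
   ([power_sum]).  Both are natural in the group, so they can be computed for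
   w_2(pi) without decomposing pi over D.

   The commutators vanish for every class that comes from GL_n, because they come
   from a copy of GL_2.  If q = 1 mod 4, then diag(c, 1) is the product of a
   square root of the scalar c and the inverse of the swap matrix, which is the
   square of a matrix over F_q; lifts of all these commute with the lifts of c
   ([commutator_form_diag2_1mod4]).  If q = 3 mod 4 the same follows for c = -1
   from a quaternion subgroup of GL_2 whose generator is inverted by diag(-1, 1)
   ([commutator_form_diag2_sign]).  On the other side, the commutators of t_i are
   zero since t_i comes from a cyclic group, and those of v_i^2 are zero since the
   cup product of degree-1 classes is symmetric.

   The powers only involve the restriction of pi to the cyclic group generated by
   h_i, which is a sum of real lines and of planes on which the generator rotates
   ([cyclic_repr_ind]).  For a group of order 2 with m copies of the sign, the
   Whitney formula gives (1 + v)^m and hence binom(m, 2) v^2 ([sw_order_two]).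
   For a cyclic group of order divisible by 4, products of degree-1 classes are
   invisible, so only the planes count; the plane with rotation z^j contributes j
   times the plane with rotation z ([sw2_cyclic_gen]), and its contribution is
   therefore governed by the parity of j, that is by the sign (-1)^j of the
   involution h_1 on it.  This turns the count into m_pi / 2, m_pi being twice the
   number of planes with j odd.  All the h_i give the same answer since the
   involutions concerned are conjugate in GL_n ([entryGL_conj]). *)

Set Implicit Arguments.
Unset Strict Implicit.
Unset Printing Implicit Defensive.

Import Order.TTheory GRing.Theory Num.Theory.
Local Open Scope ring_scope.

(** * Numerical invariants of cohomology classes in degrees 1 and 2 *)

Section Functionals.
Variables (gT : finGroupType) (k : nat).
Variable ell : {additive cochain gT k.+1 -> 'F_2}.

(** Meaningful only when ell kills coboundaries; the choice of a representative
   keeps this hypothesis out of the definition. *)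
Definition eval_class (x : cohom gT k.+1) : 'F_2 := ell (val (repr x)).

Lemma cohom_class_repr (x : cohom gT k.+1) : cohom_class (repr x) = x.
Proof. exact: reprK. Qed.

Hypothesis ell_coboundary : forall b : cochain gT k, ell (coboundary b) = 0.

Lemma eval_cohom_class (c : cocycle gT k.+1) :
  eval_class (cohom_class c) = ell (val c).
Proof.
rewrite /eval_class; have := cohom_class_repr (cohom_class c).
move: (repr _) => c' /cohom_classP/existsP[b /eqP].
rewrite raddfB /= => cE; apply/eqP; rewrite -subr_eq0 -raddfB.
by rewrite [X in ell X]cE ell_coboundary.
Qed.

Lemma eval_class_is_additive : zmod_morphism eval_class.
Proof.
move=> x y; rewrite -(cohom_class_repr x) -(cohom_class_repr y).
by rewrite -cohom_classB !eval_cohom_class !raddfB.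
Qed.

End Functionals.

Section LowDegree.
Variable gT : finGroupType.
Implicit Types (a b x y z : gT) (f : cochain gT 1) (c : cochain gT 2).

Lemma coboundary0E (f : cochain gT 0) x : cochain_at (coboundary f) [:: x] = 0.
Proof.
by rewrite coboundary_atE // /coboundary_at /= big_geq // addr0 addrr_F2.
Qed.

Lemma coboundary1E f x y : cochain_at (coboundary f) [:: x; y] =
  cochain_at f [:: y] + cochain_at f [:: (x * y)%g] + cochain_at f [:: x].
Proof. by rewrite coboundary_atE // /coboundary_at /= big_nat1. Qed.

Lemma cocycle1M (c : cocycle gT 1) x y : cochain_at c [:: (x * y)%g] =
  cochain_at c [:: x] + cochain_at c [:: y].
Proof.
have := coboundary1E c x y; rewrite (eqP (cocycleP c)) cochain_at0.
move/esym/eqP; rewrite addrAC addr_eq0 oppr_F2 => /eqP <-.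
by rewrite addrC.
Qed.

Lemma cocycle11 (c : cocycle gT 1) : cochain_at c [:: 1%g] = 0.
Proof. by have := cocycle1M c 1 1; rewrite mulg1 addrr_F2. Qed.

Lemma cocycle2P (c : cocycle gT 2) x y z :
  cochain_at c [:: x; y] + cochain_at c [:: (x * y)%g; z] =
  cochain_at c [:: y; z] + cochain_at c [:: x; (y * z)%g].
Proof.
have : cochain_at (coboundary c) [:: x; y; z] = 0.
  by rewrite (eqP (cocycleP c)) cochain_at0.
rewrite coboundary_atE // /coboundary_at /= big_nat_recl // big_nat1 /=.
move=> e; apply/eqP; rewrite -subr_eq0 oppr_F2 -{}e; apply/eqP; ring.
Qed.

Lemma cocycle2_1l (c : cocycle gT 2) y :
  cochain_at c [:: 1%g; y] = cochain_at c [:: 1%g; 1%g].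
Proof. by have := cocycle2P c 1 1 y; rewrite !mul1g => /addIr. Qed.

Lemma cocycle2_1r (c : cocycle gT 2) x :
  cochain_at c [:: x; 1%g] = cochain_at c [:: 1%g; 1%g].
Proof.
by have := cocycle2P c x 1 1; rewrite !mulg1 [RHS]addrC => /addrI.
Qed.

Definition at1 a f := cochain_at f [:: a].

Fact at1_is_additive a : zmod_morphism (at1 a).
Proof. by move=> f f'; rewrite /at1 cochain_atB. Qed.
HB.instance Definition _ a :=
  GRing.isZmodMorphism.Build (cochain gT 1) 'F_2 (at1 a) (at1_is_additive a).

Lemma at1_coboundary a (f : cochain gT 0) : at1 a (coboundary f) = 0.
Proof. exact: coboundary0E. Qed.

(** In the central extension defined by c, the n-th power of the lift of a, for a
   of order dividing n, is the central element given by this sum. *)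
Definition power_sum a n c := \sum_(l < n) cochain_at c [:: (a ^+ l)%g; a].

Fact power_sum_is_additive a n : zmod_morphism (power_sum a n).
Proof.
by move=> c c'; rewrite /power_sum -sumrB; under eq_bigr do rewrite cochain_atB.
Qed.
HB.instance Definition _ a n := GRing.isZmodMorphism.Build
  (cochain gT 2) 'F_2 (power_sum a n) (power_sum_is_additive a n).

Lemma mulrn_even_F2 (x : 'F_2) n : ~~ odd n -> x *+ n = 0.
Proof.
move=> /negPf od; rewrite -(odd_double_half n) od add0n -addnn mulrnDr.
exact: addrr_F2.
Qed.

(** The sum telescopes, up to n copies of f(a), which cancel when n is even. *)
Lemma power_sum_coboundary a n f : ~~ odd n -> (a ^+ n)%g = 1%g ->
  power_sum a n (coboundary f) = 0.
Proof.
move=> ev an1; rewrite /power_sum.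
under eq_bigr do rewrite coboundary1E -expgSr -addrA.
rewrite big_split /= sumr_const card_ord mulrn_even_F2 // add0r.
have -> : \sum_(l < n) (cochain_at f [:: (a ^+ l.+1)%g] +
    cochain_at f [:: (a ^+ l)%g]) =
  \sum_(0 <= l < n) (cochain_at f [:: (a ^+ l.+1)%g] -
    cochain_at f [:: (a ^+ l)%g]).
  by rewrite big_mkord; apply: eq_bigr => l _; rewrite oppr_F2.
by rewrite telescope_sumr // an1 expg0 subrr.
Qed.

(** For commuting a and b, the commutator of their lifts to the central extension
   defined by c. *)
Definition commutator_form a b c := cochain_at c [:: a; b] - cochain_at c [:: b; a].

Fact commutator_form_is_additive a b : zmod_morphism (commutator_form a b).
Proof. by move=> c c'; rewrite /commutator_form !cochain_atB; ring. Qed.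
HB.instance Definition _ a b := GRing.isZmodMorphism.Build
  (cochain gT 2) 'F_2 (commutator_form a b) (commutator_form_is_additive a b).

Lemma commutator_form_coboundary a b f : commute a b ->
  commutator_form a b (coboundary f) = 0.
Proof. by move=> cab; rewrite /commutator_form !coboundary1E cab; ring. Qed.

End LowDegree.

Section Pull.
Variables (gT hT : finGroupType) (f : {morphism [set: hT] >-> gT}).

Lemma at1_pull a c : at1 a (pull_cochain f c) = at1 (f a) c.
Proof. by rewrite /at1 pull_cochain_at. Qed.

Lemma power_sum_pull a n c :
  power_sum a n (pull_cochain f c) = power_sum (f a) n c.
Proof.
apply: eq_bigr => l _; rewrite pull_cochain_at //=.
by rewrite morphX ?inE.
Qed.

Lemma commutator_form_pull a b c :
  commutator_form a b (pull_cochain f c) = commutator_form (f a) (f b) c.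
Proof. by rewrite /commutator_form !pull_cochain_at. Qed.

End Pull.

(** * Sums, pullbacks and cup products of invariants *)

Section EvalMorph.
Variables (gT : finGroupType) (k : nat) (ell : {additive cochain gT k.+1 -> 'F_2}).
Hypothesis ell_coboundary : forall b : cochain gT k, ell (coboundary b) = 0.

Lemma eval_class_sum I (r : seq I) (P : pred I) (x : I -> cohom gT k.+1) :
  eval_class ell (\sum_(i <- r | P i) x i) =
  \sum_(i <- r | P i) eval_class ell (x i).
Proof.
pose phi : {additive _ -> _} := HB.pack (eval_class ell)
  (GRing.isZmodMorphism.Build _ _ (eval_class ell)
     (eval_class_is_additive ell_coboundary)).
exact: (raddf_sum phi).
Qed.

Lemma eval_classD (x y : cohom gT k.+1) :
  eval_class ell (x + y) = eval_class ell x + eval_class ell y.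
Proof.
by have := eval_class_sum [:: x; y] xpredT id; rewrite !big_cons !big_nil !addr0.
Qed.

Lemma eval_class_mulrn (x : cohom gT k.+1) m :
  eval_class ell (x *+ m) = eval_class ell x *+ m.
Proof.
have := eval_class_sum (nseq m x) xpredT id.
by rewrite !big_nseq -!Monoid.iteropE.
Qed.

End EvalMorph.

Section EvalPull.
Variables (gT hT : finGroupType) (f : {morphism [set: hT] >-> gT}).
Implicit Types a b : hT.

Lemma eval_at1_pull a (x : cohom gT 1) :
  eval_class (at1 a) (pull f x) = eval_class (at1 (f a)) x.
Proof.
rewrite -[x]cohom_class_repr pull_class !eval_cohom_class; first exact: at1_pull.
all: exact: at1_coboundary.
Qed.

Lemma eval_power_sum_pull a n (x : cohom gT 2) : ~~ odd n -> (a ^+ n)%g = 1%g ->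
  eval_class (power_sum a n) (pull f x) = eval_class (power_sum (f a) n) x.
Proof.
move=> ev an1; have fan1 : (f a ^+ n)%g = 1%g by rewrite -morphX ?inE // an1 morph1.
rewrite -[x]cohom_class_repr pull_class !eval_cohom_class.
- exact: power_sum_pull.
- by move=> b; apply: power_sum_coboundary.
- by move=> b; apply: power_sum_coboundary.
Qed.

Lemma eval_commutator_pull a b (x : cohom gT 2) : commute a b ->
  eval_class (commutator_form a b) (pull f x) =
  eval_class (commutator_form (f a) (f b)) x.
Proof.
move=> cab; have cfab : commute (f a) (f b).
  by rewrite /commute -!morphM ?inE // cab.
rewrite -[x]cohom_class_repr pull_class !eval_cohom_class.
- exact: commutator_form_pull.
- by move=> d; apply: commutator_form_coboundary.
- by move=> d; apply: commutator_form_coboundary.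
Qed.

End EvalPull.

Section EvalCup.
Variable gT : finGroupType.
Implicit Types (a b : gT) (x y : cohom gT 1).

Lemma cup1x k (e : (0 + k)%N = k) (x : cohom gT k) : cup e (cohom1 gT) x = x.
Proof.
rewrite -[x]reprK -/(cohom_class _) cup_class; congr cohom_class.
apply/val_inj/ffunP=> t; rewrite ffunE take0 drop0 cochain_atE.
by rewrite (@cochain_at_size _ _ _ [::]) // ffunE mul1r.
Qed.

Lemma cupx1 k (e : (k + 0)%N = k) (x : cohom gT k) : cup e x (cohom1 gT) = x.
Proof.
rewrite -[x]reprK -/(cohom_class _) cup_class; congr cohom_class.
apply/val_inj/ffunP=> t; rewrite ffunE.
rewrite take_oversize ?size_tuple // drop_oversize ?size_tuple // cochain_atE.
by rewrite (@cochain_at_size _ _ _ [::]) // ffunE mulr1.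
Qed.

Lemma cochain_at_cup11 (e : (1 + 1)%N = 2) (c d : cochain gT 1) a b :
  cochain_at (cup_cochain e c d) [:: a; b] = at1 a c * at1 b d.
Proof. by rewrite cup_cochain_at. Qed.

Lemma cocycle1X (c : cocycle gT 1) a l : at1 (a ^+ l)%g c = at1 a c *+ l.
Proof.
elim: l => [|l IHl]; first exact: cocycle11.
by rewrite expgSr mulrSr -IHl; exact: cocycle1M.
Qed.

(** The powers of a contribute 0 + 1 + ... + (n - 1) copies of x(a) y(a). *)
Lemma eval_power_sum_cup (e : (1 + 1)%N = 2) a n x y :
    ~~ odd n -> (a ^+ n)%g = 1%g ->
  eval_class (power_sum a n) (cup e x y) =
  (eval_class (at1 a) x * eval_class (at1 a) y) *+ 'C(n, 2).
Proof.
move=> ev an1.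
rewrite -[x]cohom_class_repr -[y]cohom_class_repr cup_class.
rewrite !eval_cohom_class; try exact: at1_coboundary;
  last by move=> b; apply: power_sum_coboundary.
rewrite /= /power_sum; under eq_bigr do rewrite cochain_at_cup11 cocycle1X mulrnAl.
by rewrite sumrMnr -bin2_sum big_mkord.
Qed.

Lemma eval_commutator_cup (e : (1 + 1)%N = 2) a b x y : commute a b ->
  eval_class (commutator_form a b) (cup e x y) =
  eval_class (at1 a) x * eval_class (at1 b) y -
  eval_class (at1 b) x * eval_class (at1 a) y.
Proof.
move=> cab; rewrite -[x]cohom_class_repr -[y]cohom_class_repr cup_class.
rewrite !eval_cohom_class; first by rewrite /= /commutator_form !cochain_at_cup11.
all: try exact: at1_coboundary.
by move=> f; apply: commutator_form_coboundary.
Qed.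

End EvalCup.

(** * The central extension defined by a 2-cocycle *)

Section CentralExtension.
Variable gT : finGroupType.

(** The cocycle is an argument so that each extension carries its own group law;
   it is not assumed to be normalised, whence the neutral element (c(1, 1), 1). *)
Definition extension (c : cocycle gT 2) : Type := ('F_2 * gT)%type.
HB.instance Definition _ c := Finite.on (extension c).

Variable c : cocycle gT 2.

Let c2 x y := cochain_at c [:: x; y].

Definition ext_one : extension c := (c2 1 1, 1%g).
Definition ext_mul (u v : extension c) : extension c :=
  (u.1 + v.1 + c2 u.2 v.2, (u.2 * v.2)%g).
Definition ext_inv (u : extension c) : extension c :=
  (u.1 + c2 u.2^-1 u.2 + c2 1 1, u.2^-1%g).

Fact ext_mulA : associative ext_mul.
Proof.
move=> u v w; rewrite /ext_mul /= mulgA; congr pair.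
have := cocycle2P c u.2 v.2 w.2; rewrite -!/(c2 _ _) => e.
transitivity (u.1 + v.1 + w.1 + (c2 v.2 w.2 + c2 u.2 (v.2 * w.2))).
  by ring.
by rewrite -e; ring.
Qed.

Fact ext_mul1 : left_id ext_one ext_mul.
Proof.
move=> [e x]; rewrite /ext_mul /= mul1g {2}/c2 cocycle2_1l -/(c2 _ _).
by rewrite addrAC addrr_F2 add0r.
Qed.

Fact ext_mulr1 : right_id ext_one ext_mul.
Proof.
move=> [e x]; rewrite /ext_mul /= mulg1 {2}/c2 cocycle2_1r -/(c2 _ _).
by rewrite -addrA addrr_F2 addr0.
Qed.

Fact ext_mulV : left_inverse ext_one ext_inv ext_mul.
Proof.
move=> [e x]; rewrite /ext_mul /ext_inv /ext_one /= mulVg; congr pair.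
set y := c2 _ x; rewrite -[RHS]add0r -(addrr_F2 (e + y)); ring.
Qed.

Fact ext_mulrV : right_inverse ext_one ext_inv ext_mul.
Proof.
move=> u; set v := ext_inv u.
rewrite -[ext_mul u v]ext_mul1 -(ext_mulV v) -ext_mulA (ext_mulA v).
by rewrite (ext_mulV u) ext_mul1 ext_mulV.
Qed.

HB.instance Definition _ := isGroup.Build (extension c)
  ext_mulA ext_mul1 ext_mulr1 ext_mulV ext_mulrV.

Definition lift_elt x : extension c := (0, x).

Lemma ext_mulE (u v : extension c) :
  (u * v)%g = (u.1 + v.1 + c2 u.2 v.2, (u.2 * v.2)%g) :> 'F_2 * gT.
Proof. by []. Qed.

Lemma ext_snd_prod I (r : seq I) (u : I -> extension c) :
  (\prod_(i <- r) u i)%g.2 = (\prod_(i <- r) (u i).2)%g.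
Proof. exact: (big_morph (fun u : extension c => u.2)). Qed.

Lemma ext_sndX (u : extension c) n : (u ^+ n)%g.2 = (u.2 ^+ n)%g.
Proof. by elim: n => // n IHn; rewrite !expgS -IHn. Qed.

Lemma ext_kernel_central (u v : extension c) : u.2 = 1%g -> commute u v.
Proof.
case: u v => [e x] [e' y] /= ->; rewrite /commute !ext_mulE /= mul1g mulg1.
by rewrite /c2 cocycle2_1l cocycle2_1r [e + e']addrC.
Qed.

Lemma commute_lift a b : commute a b ->
  eval_class (commutator_form a b) (cohom_class c) = 0 <->
  commute (lift_elt a) (lift_elt b).
Proof.
move=> cab; rewrite eval_cohom_class; last first.
  by move=> f; apply: commutator_form_coboundary.
rewrite /commute !ext_mulE /= !addr0 !add0r cab.
by split=> [/subr0_eq e|[e]]; [congr pair | rewrite /commutator_form -!/(c2 _ _) e subrr].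
Qed.

Lemma lift_eltX a n : (lift_elt a ^+ n)%g =
  (c2 1 1 + power_sum a n c, (a ^+ n)%g) :> 'F_2 * gT.
Proof.
elim: n => [|n IHn]; first by rewrite /power_sum big_ord0 addr0.
by rewrite !expgSr ext_mulE IHn /= addr0 /power_sum big_ord_recr addrA.
Qed.

End CentralExtension.

(** * Commuting lifts and splittings of central extensions *)

Section CommutingLifts.
Variables (gT : finGroupType) (c : cocycle gT 2).
Implicit Types u v : extension c.
Local Open Scope group_scope.

Lemma ext_sqr_eq u v : u.2 = v.2 -> u * u = v * v.
Proof. by move=> e; rewrite !ext_mulE e !addrr_F2. Qed.

(** Commutation of lifts only depends on the elements lifted, since two lifts of
   one element differ by a central factor. *)
Lemma ext_commute_eq u u' v : u.2 = u'.2 -> commute u v -> commute u' v.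
Proof.
move=> e cuv; rewrite -[u'](mulgKV u); apply: commute_sym; apply: commuteM.
  by apply/commute_sym/ext_kernel_central; rewrite ext_mulE /= -e mulgV.
exact: commute_sym.
Qed.

(** Conjugation by v changes u by a central sign, which disappears on squaring. *)
Lemma ext_commute_sqr u v : commute u.2 v.2 -> commute (u * u) v.
Proof.
move=> cuv; apply/commgP/conjg_fixP; rewrite conjMg; apply: ext_sqr_eq.
by apply/conjg_fixP/commgP.
Qed.

Lemma ext_commute_lift a b u v : commute a b -> u.2 = a -> v.2 = b ->
  commute u v -> eval_class (commutator_form a b) (cohom_class c) = 0.
Proof.
move=> cab ua vb cuv; apply/(commute_lift _ cab).
apply: (ext_commute_eq (u := u)) => //.
by apply/commute_sym/(ext_commute_eq (u := v)) => //; apply/commute_sym.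
Qed.

End CommutingLifts.

Section VanishingCommutators.
Variables (gT : finGroupType) (x : cohom gT 2).
Local Open Scope group_scope.

(** The lift of a s^2 commutes with its own square, which lifts z = (a s^2)^2, and
   the lift of s^2 commutes with the lifts of z because s and z commute.  Hence so
   does the quotient of these two lifts, a lift of a. *)
Lemma commutator_form_sqr a s : commute s ((a * (s * s)) ^+ 2) ->
    commute a ((a * (s * s)) ^+ 2) ->
  eval_class (commutator_form a (a^-1 * (a * (s * s)) ^+ 2)) x = 0%R.
Proof.
set z := _ ^+ 2 => csz caz; rewrite -[x]cohom_class_repr.
set c := repr x; pose A := lift_elt c a; pose S := lift_elt c s.
pose Z := (A * (S * S)) ^+ 2.
have cAZ : commute A Z.
  rewrite -[A](mulgK (S * S)); apply: commute_sym; apply: commuteM.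
    exact/commute_sym/commuteX.
  by apply/commuteV/commute_sym/ext_commute_sqr; rewrite /Z ext_sndX.
apply: (ext_commute_lift (u := A) (v := A^-1 * Z)) => //.
- by apply: commuteM => //; apply: commuteV.
- by apply: commuteM => //; apply: commuteV.
Qed.

(** In a central extension of the quaternion group generated by j and k the
   lifts of j^2 = k^2 have order at most 2: the square of a lift of k is both
   fixed and inverted by a lift of j. Hence a lift of h, which inverts j, fixes
   the square of a lift of j. *)
Lemma commutator_form_quaternion h j k : j * j = k * k ->
    k ^ j = k^-1 -> j ^ h = j^-1 -> (j * j) * (j * j) = 1 ->
  eval_class (commutator_form h (h^-1 * (j * j))) x = 0%R.
Proof.
move=> jk kj jh j4; rewrite -[x]cohom_class_repr; set c := repr x.
pose H := lift_elt c h; pose J := lift_elt c j; pose K := lift_elt c k.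
have KK : K * K = (K * K)^-1.
  have KJ : commute (K * K) J.
    apply: (ext_commute_eq (u := J * J)) => //.
    by apply/commute_sym/commuteM.
  rewrite invMg -(ext_sqr_eq (u := K ^ J) (v := K^-1)) // -conjMg.
  exact/esym/conjg_fixP/commgP.
have J4 : J * J = (J * J)^-1.
  rewrite -[LHS]mulg1 -(mulgV (J * J)) mulgA (ext_sqr_eq (u := J * J) (v := K * K)) //.
  by rewrite {2}KK mulgV mul1g.
have cHJ : commute H (J * J).
  apply/commute_sym/commgP/conjg_fixP; rewrite conjMg J4 invMg.
  exact: ext_sqr_eq.
have chj : commute h (j * j).
  apply/commute_sym/commgP/conjg_fixP; rewrite conjMg jh -invMg.
  by apply/eqP; rewrite eq_invg_mul j4.
apply: (ext_commute_lift (u := H) (v := H^-1 * (J * J))) => //.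
- by apply: commuteM => //; apply: commuteV.
- by apply: commuteM => //; apply: commuteV.
Qed.

(** The m-th power of the lift of a is a lift of a^m, up to a central sign that the
   even exponent n kills. *)
Lemma eval_power_sumX a n m : ~~ odd n -> a ^+ n = 1 ->
  eval_class (power_sum (a ^+ m) n) x =
  (eval_class (power_sum a n) x *+ m)%R.
Proof.
move=> ev an1; have amn1 : (a ^+ m) ^+ n = 1 by rewrite expgAC an1 expg1n.
rewrite -[x]cohom_class_repr; set c := repr x.
rewrite !eval_cohom_class; try by move=> ?; apply: power_sum_coboundary.
have even_eq (u v : extension c) : u.2 = v.2 -> u ^+ n = v ^+ n.
  move=> uv; rewrite -(odd_double_half n) (negPf ev) add0n -mul2n !expgM.
  by rewrite !expg2 (ext_sqr_eq uv).
have := even_eq (lift_elt c (a ^+ m)) (lift_elt c a ^+ m).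
rewrite ext_sndX => /(_ erefl); rewrite expgAC.
pose c11 := cochain_at c [:: 1; 1]; pose ps := power_sum a n c.
have pow i : (((c11 + ps)%R, 1) : extension c) ^+ i
    = ((c11 + ps *+ i)%R, 1) :> 'F_2 * gT.
  elim: i => [|i IHi]; first by rewrite mulr0n addr0.
  rewrite expgS ext_mulE IHi /= mulg1 mulrS; congr pair.
  rewrite -[RHS]addr0 -(addrr_F2 c11) -/c11.
  by ring.
have -> : lift_elt c a ^+ n = (((c11 + ps)%R, 1) : extension c).
  by rewrite -an1 -lift_eltX.
rewrite pow lift_eltX amn1 => /(congr1 fst) /= e.
by apply: (@addrI _ c11); exact: e.
Qed.

End VanishingCommutators.

Section Detection.
Variables (gT : finGroupType).
Local Open Scope group_scope.

Lemma prodgX_commute (hT : groupType) I (r : seq I) (u : I -> hT) (m m' : I -> nat) :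
    (forall i j, commute (u i) (u j)) ->
  (\prod_(i <- r) u i ^+ m i) * (\prod_(i <- r) u i ^+ m' i) =
  \prod_(i <- r) u i ^+ (m i + m' i)%N.
Proof.
move=> cu; elim: r => [|i r IHr]; first by rewrite !big_nil mulg1.
rewrite !big_cons -IHr expgD !mulgA; congr (_ * _); rewrite -!mulgA; congr (_ * _).
apply: commute_sym; elim: r {IHr} => [|j r IHr]; first by rewrite big_nil; exact: commute1.
by rewrite big_cons; apply: commuteM => //; apply: commuteX2.
Qed.

(** A central extension of an abelian group splits as soon as the lifts of
   generators can be chosen to commute and to satisfy the relations; the
   splitting then trivialises the cocycle. *)
Lemma cohom2_eq0 I (e : seq I) (h : I -> gT) (k : nat) (r : I -> gT -> nat)
    (x : cohom gT 2) :
    ~~ odd k -> (forall i, h i ^+ k = 1) ->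
    (forall i j, commute (h i) (h j)) ->
    (forall d, d = \prod_(i <- e) h i ^+ r i d) ->
    (forall i d d', r i (d * d')%g = r i d + r i d' %[mod k])%N ->
    (forall i, eval_class (power_sum (h i) k) x = 0%R) ->
    (forall i j, eval_class (commutator_form (h i) (h j)) x = 0%R) ->
  x = 0%R.
Proof.
move=> ev hk chh hE rM; rewrite -[x]cohom_class_repr; move: (repr x) => c pow0 com0.
pose H i := lift_elt c (h i).
have cHH i j : commute (H i) (H j) by apply/commute_lift.
have Hk i : H i ^+ k = 1.
  have := pow0 i; rewrite eval_cohom_class; last first.
    by move=> ?; apply: power_sum_coboundary.
  by move=> e0; rewrite lift_eltX [power_sum _ _ _]e0 addr0 hk.
pose s d := \prod_(i <- e) H i ^+ r i d.
have sM d d' : s (d * d') = s d * s d'.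
  rewrite prodgX_commute //; apply: eq_bigr => i _.
  by rewrite -(expg_mod _ (Hk i)) rM expg_mod.
have s2 d : (s d).2 = d.
  by rewrite ext_snd_prod {2}[d]hE; apply: eq_bigr => i _; rewrite ext_sndX.
apply: (@etrans _ _ (cohom_class 0%R)); last exact: raddf0.
apply/cohom_classP; rewrite subr0; apply/existsP.
pose b : cochain gT 1 := [ffun t : 1.-tuple gT => (s (thead t)).1].
have bE y : cochain_at b [:: y] = (s y).1.
  by rewrite (@cochain_at_size _ 1 _ [:: y] isT) ffunE.
exists b; apply/eqP/ffunP=> -[[|y [|z []]] // sz].
rewrite -!cochain_atE /= coboundary1E !bE sM ext_mulE /= !s2.
set p := (s z).1; set q := (s y).1; set w := cochain_at _ _.
by rewrite -[LHS]addr0 -(addrr_F2 (p + q)); ring.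
Qed.

End Detection.

(** * Real representations of cyclic groups *)

Section Splitting.
Variables (F : fieldType) (gT : finGroupType) (G : {group gT}).

(** Maschke's theorem for the image of an injective intertwining operator. *)
Lemma rsim_dadd_split n (rG : mx_representation F G n) s
    (sG : mx_representation F G s) (B : 'M_(s, n)) :
    pgroup [pchar F]^' G -> row_free B ->
    {in G, forall x, sG x *m B = B *m rG x} ->
  exists rho, mx_rsim rG (dadd_grepr (Representation sG) rho).
Proof.
move=> F'G freeB homB; pose U := <<B>>%MS.
have modU : mxmodule rG U.
  apply/mxmoduleP=> x Gx; rewrite (eqmxMr _ (genmxE B)) genmxE -homB //.
  exact: submxMl.
have sBU : (B <= U)%MS by rewrite genmxE.
have [W modW defUW dxUW] := mx_Maschke_pchar rG F'G modU (submx1 U).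
exists (Representation (submod_repr modW)).
apply: mx_rsim_trans (mx_rsim_sym (rsim_submod1 (mxmodule1 rG) _)) _ => //.
apply: (mx_rsim_dadd (modU := modU) (modV := modW)) => //=.
  apply: mx_rsim_sym; exists (in_submod U B).
  - by rewrite genmxE; apply/esym/eqP.
  - by rewrite /row_free mxrank_in_submod.
  - move=> x Gx; rewrite -(in_submodJ modU) // -homB //.
    by rewrite [in LHS]in_submodE mulmxA -in_submodE.
exact: mx_rsim_refl.
Qed.

End Splitting.

Section CyclicRepresentations.
Variables (R : realType) (k : nat).

Let C : finGroupType := 'I_k.+1.

Lemma Zp_mulgE (x y : C) : (x * y)%g = ((x + y) %% k.+1)%N :> nat.
Proof. by []. Qed.

Lemma Zp1_expg_order : (Zp1 ^+ k.+1 = 1 :> C)%g.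
Proof. by apply/val_inj; rewrite Zp_expg /= modnMl. Qed.

Section LinearRepr.
Variables (a : R) (ak1 : a ^+ k.+1 = 1).

Fact linear_repr_subproof :
  mx_repr [set: C] (fun x => (a ^+ (x : nat))%:M : 'M[R]_1).
Proof. by split=> // x y _ _; rewrite Zp_mulgE expr_mod // exprD scalar_mxM. Qed.

Definition linear_repr : representation R [set: C] :=
  Representation (MxRepresentation linear_repr_subproof).

End LinearRepr.

Section Rotation.
Variables (l : R[i]) (lk1 : l ^+ k.+1 = 1).

Definition cyclic_char (x : C) : R[i] := l ^+ (x : nat).

Fact cyclic_char1 : cyclic_char 1%g = 1.
Proof. by []. Qed.

Fact cyclic_charM : {morph cyclic_char : x y / (x * y)%g >-> x * y}.
Proof. by move=> x y; rewrite /cyclic_char Zp_mulgE expr_mod // exprD. Qed.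

Definition rotation_repr : representation R [set: C] :=
  real_of_char cyclic_char1 cyclic_charM.

End Rotation.

Lemma cyclic_intertwine n (rG : mx_representation R [set: C] n) s
    (sG : mx_representation R [set: C] s) (B : 'M_(s, n)) :
    sG Zp1 *m B = B *m rG Zp1 ->
  {in [set: C], forall x, sG x *m B = B *m rG x}.
Proof.
move=> hB x _; rewrite -(Zp1_expgz x); elim: (x : nat) => [|i IHi].
  by rewrite expg0 !repr_mx1 mul1mx mulmx1.
by rewrite expgSr !repr_mxM ?inE // -mulmxA hB mulmxA IHi mulmxA.
Qed.

Lemma real_mx_mul n (l : R[i]) (x y : 'rV[R]_n) :
  real_mx l *m col_mx x y =
  col_mx (complex.Re l *: x + complex.Im l *: y)
         (- complex.Im l *: x + complex.Re l *: y).
Proof.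
by rewrite /real_mx mul_block_col !mul_scalar_mx.
Qed.

(** For a complex eigenvector v of M with eigenvalue l, take x and y to be the real
   part of v and the opposite of its imaginary part.  When l is not real they are
   independent, as v and its conjugate have distinct eigenvalues. *)
Lemma real_eigenplane n (M : 'M[R]_n) : (0 < n)%N ->
  exists (l : R[i]) (x y : 'rV[R]_n),
    [/\ real_mx l *m col_mx x y = col_mx x y *m M, col_mx x y != 0 &
        complex.Im l != 0 -> row_free (col_mx x y)].
Proof.
move=> n_gt0; have [l] := eigenvalue_closed (map_mx (real_complex R) M) n_gt0.
case/eigenvalueP=> v vM v0.
pose x := map_mx (@complex.Re R) v; pose y := - map_mx (@complex.Im R) v.
have xM : x *m M = complex.Re l *: x + complex.Im l *: y.
  apply/rowP=> j; have := congr1 (fun w : 'rV[R[i]]_n => complex.Re (w 0 j)) vM.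
  rewrite !mxE raddf_sum /= => e.
  rewrite -[LHS]/(\sum_(i < n) _); under eq_bigr do rewrite mxE.
  transitivity (complex.Re (l * v 0 j)); last first.
    by case: (l) (v 0 j) => [a b] [c d] /=; ring.
  rewrite -e; apply: eq_bigr => i _; rewrite !mxE.
  by case: (v 0 i) => [c d] /=; ring.
have yM : y *m M = - complex.Im l *: x + complex.Re l *: y.
  apply/rowP=> j; have := congr1 (fun w : 'rV[R[i]]_n => complex.Im (w 0 j)) vM.
  rewrite !mxE raddf_sum /= => e.
  rewrite -[LHS]/(\sum_(i < n) _); under eq_bigr do rewrite !mxE mulNr.
  rewrite sumrN.
  transitivity (- complex.Im (l * v 0 j)); last first.
    by case: (l) (v 0 j) => [a b] [c d] /=; ring.
  rewrite -e; congr (- _); apply: eq_bigr => i _; rewrite !mxE.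
  by case: (v 0 i) => [c d] /=; ring.
have xy0 : x = 0 -> y = 0 -> False.
  move=> x0 y0; case/eqP: v0; apply/rowP=> j; rewrite mxE.
  have := congr1 (fun w : 'rV[R]_n => w 0 j) x0.
  have := congr1 (fun w : 'rV[R]_n => w 0 j) y0; rewrite !mxE.
  by case: (v 0 j) => [a b] /= /eqP; rewrite oppr_eq0 => /eqP -> ->.
have eM : real_mx l *m col_mx x y = col_mx x y *m M.
  by rewrite real_mx_mul mul_col_mx xM yM.
exists l, x, y; split=> //.
  apply/negP=> /eqP; rewrite -[0]col_mx0 => /eq_col_mx[x0 y0]; exact: xy0.
(* A relation w is mapped by real_mx l to another relation, which is independent
   of w since l is not real; so w would kill both x and y. *)
move=> b0; apply: inj_row_free => w wB.
have mulw (x' y' : 'rV[R]_n) : w *m col_mx x' y' =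
    lsubmx w 0 0 *: x' + rsubmx w 0 0 *: y'.
  rewrite -[w in LHS]hsubmxK mul_row_col.
  by rewrite [lsubmx w in LHS]mx11_scalar [rsubmx w in LHS]mx11_scalar !mul_scalar_mx.
have wB' : w *m (real_mx l *m col_mx x y) = 0 by rewrite eM mulmxA wB mul0mx.
rewrite real_mx_mul !mulw in wB wB'.
set p := lsubmx w 0 0 in wB wB'; set q := rsubmx w 0 0 in wB wB'.
have pq : p *: y - q *: x = 0.
  apply: (scalerI b0); rewrite scaler0.
  have <- : p *: (complex.Re l *: x + complex.Im l *: y) +
      q *: (- complex.Im l *: x + complex.Re l *: y)
      - complex.Re l *: (p *: x + q *: y) = 0 by rewrite wB wB' scaler0 subr0.
  by apply/rowP=> j; rewrite !mxE; ring.
have sx : (p ^+ 2 + q ^+ 2) *: x = 0.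
  have <- : p *: (p *: x + q *: y) - q *: (p *: y - q *: x) = 0.
    by rewrite wB pq !scaler0 subr0.
  by apply/rowP=> j; rewrite !mxE; ring.
have sy : (p ^+ 2 + q ^+ 2) *: y = 0.
  have <- : q *: (p *: x + q *: y) + p *: (p *: y - q *: x) = 0.
    by rewrite wB pq !scaler0 addr0.
  by apply/rowP=> j; rewrite !mxE; ring.
have : p ^+ 2 + q ^+ 2 = 0.
  apply/eqP; apply: contraT => s0; case: xy0.
    by apply: (scalerI s0); rewrite sx scaler0.
  by apply: (scalerI s0); rewrite sy scaler0.
move/eqP; rewrite paddr_eq0 ?sqr_ge0 // !sqrf_eq0 => /andP[/eqP p0 /eqP q0].
rewrite -[w]hsubmxK [lsubmx w]mx11_scalar [rsubmx w]mx11_scalar.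
by rewrite -/p -/q p0 q0 !raddf0 row_mx0.
Qed.

Lemma char_real_pgroup (gT : finGroupType) (G : {group gT}) :
  pgroup [pchar R]^' G.
Proof. by apply/pgroupP=> p _ _; rewrite inE /= pchar_num. Qed.

(** A complex eigenvector of the generator spans with its conjugate an invariant
   line or plane, which has an invariant complement; the eigenvalue l satisfies
   l^(k + 1) = 1 because the generator has order k + 1. *)
Lemma cyclic_repr_ind (P : representation R [set: C] -> Prop) :
    (forall rho, rdegree rho = 0%N -> P rho) ->
    (forall rho sigma : representation R [set: C],
       mx_rsim rho sigma -> P sigma -> P rho) ->
    (forall a (ak1 : a ^+ k.+1 = 1) rho,
       P rho -> P (dadd_grepr (linear_repr ak1) rho)) ->
    (forall l (lk1 : l ^+ k.+1 = 1) rho, complex.Im l != 0 ->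
       P rho -> P (dadd_grepr (rotation_repr lk1) rho)) ->
  forall rho, P rho.
Proof.
move=> P0 Psim Plin Prot rho; have [d] := ubnP (rdegree rho).
elim: d rho => // d IHd rho; rewrite ltnS => le_d.
have [/P0 //|d_gt0] := posnP (rdegree rho).
have [l [x [y [eM xy0 freexy]]]] := real_eigenplane (rho Zp1) d_gt0.
have powM i : real_mx (l ^+ i) *m col_mx x y = col_mx x y *m rho (Zp1 ^+ i)%g.
  elim: i => [|i IHi]; first by rewrite real_mx1 expg0 repr_mx1 mul1mx mulmx1.
  rewrite exprSr real_mxM -mulmxA eM mulmxA IHi -mulmxA.
  by rewrite expgSr repr_mxM ?inE.
have := powM k.+1; rewrite Zp1_expg_order repr_mx1 mulmx1 => lk.
have sim_lt s (sG' : mx_representation R [set: C] s) (B : 'M_(s, rdegree rho)) :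
    (0 < s)%N -> row_free B -> sG' Zp1 *m B = B *m rho Zp1 ->
    (forall sigma, P sigma -> P (dadd_grepr (Representation sG') sigma)) -> P rho.
  move=> s_gt0 freeB /cyclic_intertwine homB Pd.
  have [sigma sim] := rsim_dadd_split (char_real_pgroup _) freeB homB.
  have /= ds := mxrank_rsim sim.
  apply: Psim sim _; apply/Pd/IHd.
  by apply: leq_trans le_d; rewrite ds -[ltnLHS]add0n ltn_add2r.
have [b0|b0] := eqVneq (complex.Im l) 0.
  have lin (v : 'rV_(rdegree rho)) : v != 0 ->
      complex.Re l *: v = v *m rho Zp1 -> P rho.
    move=> v0 vM.
    have ak1 : complex.Re l ^+ k.+1 = 1.
      have : complex.Re l ^+ k.+1 *: v = v.
        rewrite -[RHS]mulmx1 -[X in _ *m X](repr_mx1 rho) -Zp1_expg_order.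
        elim: k.+1 => [|i IHi]; first by rewrite expr0 scale1r repr_mx1 mulmx1.
        by rewrite exprSr expgSr repr_mxM ?inE // mulmxA -IHi -scalemxAl -vM scalerA.
      move/eqP; rewrite -subr_eq0 -[X in _ - X]scale1r -scalerBl scaler_eq0.
      by rewrite (negPf v0) orbF subr_eq0 => /eqP.
    apply: (sim_lt _ (linear_repr ak1) v) => //.
    - by rewrite /row_free rank_rV v0.
    - by rewrite /= expr_mod // expr1 mul_scalar_mx.
    - by move=> sigma; apply: Plin.
  have := eM; rewrite real_mx_mul b0 oppr0 !scale0r addr0 add0r mul_col_mx.
  case/eq_col_mx=> xM yM; have [x0|] := eqVneq x 0; last by move/lin; apply.
  apply: (lin y) => //; apply: contraNneq xy0 => y0.
  by rewrite x0 y0 col_mx0.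
have lk1 : l ^+ k.+1 = 1.
  have := row_free_inj (freexy b0) (etrans lk (esym (mul1mx _))).
  rewrite -real_mx1 /real_mx => /eq_block_mx[].
  move=> /(congr1 (fun A : 'M[R]_1 => A 0 0)) cE.
  move=> /(congr1 (fun A : 'M[R]_1 => A 0 0)) dE _ _.
  move: cE dE; case: (l ^+ k.+1) => u v /=; rewrite !mxE !mulr1n => -> ->.
  by [].
apply: (sim_lt _ (rotation_repr lk1) (col_mx x y)) => //.
- exact: freexy.
- by rewrite /= /cyclic_char expr_mod // expr1.
- by move=> sigma; apply: Prot.
Qed.

End CyclicRepresentations.

(** * Stiefel-Whitney classes over cyclic groups *)

Section StiefelWhitney.
Variables (R : realType) (W : SW_theory R).

Section Whitney.
Variable gT : finGroupType.
Implicit Types rho sigma : representation R [set: gT].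

Lemma sw1_dadd rho sigma :
  sw W (dadd_grepr rho sigma) 1 = sw W sigma 1 + sw W rho 1.
Proof.
by rewrite sw_whitney !big_ord_recl big_ord0 addr0 !sw_zero cup1x cupx1.
Qed.

Lemma sw2_dadd rho sigma : sw W (dadd_grepr rho sigma) 2 =
  sw W sigma 2 + @cup _ 1 1 2 erefl (sw W rho 1) (sw W sigma 1) + sw W rho 2.
Proof.
rewrite sw_whitney !big_ord_recl big_ord0 addr0 !sw_zero cup1x cupx1 addrA.
by congr (_ + cup _ _ _ + _); apply: eq_irrelevance.
Qed.

Lemma mxtrace_dadd rho sigma x :
  \tr (dadd_grepr rho sigma x) = \tr (rho x) + \tr (sigma x).
Proof. exact: mxtrace_block. Qed.

Lemma eval_class0 k (ell : {additive cochain gT k.+1 -> 'F_2}) :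
  (forall b : cochain gT k, ell (coboundary b) = 0) ->
  eval_class ell 0 = 0.
Proof. by move=> d0; have := eval_class_mulrn d0 0 0; rewrite !mulr0n. Qed.

Lemma eq_rsim rho (s : mx_representation R [set: gT] (rdegree rho)) :
  (forall x, rho x = s x) -> mx_rsim rho s.
Proof.
move=> e; exists 1%:M => // [|x _]; last by rewrite mul1mx mulmx1 e.
by rewrite /row_free mxrank1.
Qed.

(** A trivial representation is its own pullback along the trivial morphism, and
   1-cocycles vanish at 1. *)
Lemma at1_sw_trivial rho a : (forall x, rho x = 1%:M) ->
  eval_class (at1 a) (sw W rho 1) = 0.
Proof.
move=> triv; have sim : mx_rsim rho (pull_repr (trivm [set: gT]) rho).
  by apply: eq_rsim => x; rewrite /= !triv.
rewrite (sw_iso W sim) sw_natural eval_at1_pull.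
exact: cocycle11.
Qed.

End Whitney.

Section OrderTwo.
Let C2 : finGroupType := 'I_2.

Lemma C2_cases (x : C2) : x = 1%g \/ x = Zp1.
Proof.
by case: x => -[|[|//]] lt; [left | right]; apply/val_inj.
Qed.

(** By normalisation the class is nonzero, and a class of degree 1 is determined by
   its value at the generator. *)
Lemma at1_sw_sign (a2 : (- 1) ^+ 2 = 1 :> R) :
  eval_class (at1 (Zp1 : C2)) (sw W (linear_repr a2) 1) = 1.
Proof.
have : sw W (linear_repr a2) 1 != 0.
  apply: sw_normalized; rewrite ?card_ord //.
  exists Zp1; rewrite /= expr1; apply/eqP=> /matrixP/(_ 0 0).
  rewrite !mxE !mulr1n => /eqP; rewrite eq_sym -subr_eq0 opprK.
  by rewrite -(natrD _ 1 1) pnatr_eq0.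
set w := sw _ _ _; suff w0 : eval_class (at1 (Zp1 : C2)) w = 0 -> w = 0.
  have : eval_class (at1 (Zp1 : C2)) w != 0 -> eval_class (at1 (Zp1 : C2)) w = 1.
    by case: (eval_class _ _) => -[|[|//]] lt // _; apply/val_inj.
  by move=> h /eqP wn0; apply: h; apply/eqP => /w0.
rewrite -[w]cohom_class_repr; move: (repr w) => c {w}.
rewrite eval_cohom_class; last exact: at1_coboundary.
move=> c1; have -> : c = 0; last exact: raddf0.
apply/val_inj/ffunP => -[[|x [|]] // sz]; rewrite -cochain_atE ffunE /=.
by case: (C2_cases x) => ->; [exact: cocycle11 | exact: c1].
Qed.

(** With m the multiplicity of the sign representation, whose class is v, the total
   class is (1 + v)^m. *)
Lemma sw_order_two (rho : representation R [set: C2]) : exists m,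
  [/\ \tr (rho Zp1) = (rdegree rho)%:R - 2%:R * m%:R,
      eval_class (at1 (Zp1 : C2)) (sw W rho 1) = m%:R &
      eval_class (power_sum (Zp1 : C2) 2) (sw W rho 2) = 'C(m, 2)%:R].
Proof.
have d1 (b : cochain C2 0) : at1 (Zp1 : C2) (coboundary b) = 0.
  exact: at1_coboundary.
have d2 (b : cochain C2 1) : power_sum (Zp1 : C2) 2 (coboundary b) = 0.
  by apply: power_sum_coboundary => //; apply: Zp1_expg_order.
elim/cyclic_repr_ind: rho => [rho d0|rho sigma sim [m [trm w1m w2m]]|a a2 rho|l l2 rho Im0].
- exists 0%N; rewrite !sw_rank ?d0 // !eval_class0 //; split=> //.
  rewrite mulr0 subr0.
  by move: (rho Zp1 : 'M[R]__); rewrite d0 => M; rewrite [M]flatmx0 mxtrace0.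
- exists m; rewrite !(sw_iso W sim) (mxtrace_rsim sim) ?inE //.
  by rewrite (mxrank_rsim sim).
- case=> m [trm w1m w2m].
  have [b [bE aE w1a]] : exists b : bool, [/\ a = (- 1) ^+ b,
     \tr (linear_repr a2 Zp1) = 1 - 2%:R * b%:R &
     eval_class (at1 (Zp1 : C2)) (sw W (linear_repr a2) 1) = b%:R].
    move/eqP: (a2); rewrite sqrf_eq1 => /orP[]/eqP ea; subst a.
      exists false; split=> //; rewrite /= ?mxtrace_scalar ?expr1 ?mulr0 ?subr0 //.
      by apply: at1_sw_trivial => x /=; rewrite expr1n.
    exists true; split=> //; last exact: at1_sw_sign.
    by rewrite /= mxtrace_scalar expr1; ring.
  exists (b + m)%N; rewrite mxtrace_dadd aE trm sw1_dadd sw2_dadd.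
  rewrite !eval_classD // eval_power_sum_cup //; last exact: Zp1_expg_order.
  rewrite w1a w1m w2m (@sw_rank _ _ _ (linear_repr a2)) // eval_class0 // addr0.
  split=> /=; [by rewrite !natrD; ring|by rewrite natrD addrC|].
  rewrite binn mulr1n; case: (b); rewrite /= ?mul0r ?addr0 //.
  by rewrite mul1r binS bin1 natrD.
- (* The square roots of 1 are real. *)
  move/eqP: (l2).
  by rewrite sqrf_eq1 => /orP[]/eqP le; rewrite le /= ?oppr0 eqxx in Im0.
Qed.

End OrderTwo.

Section OrderDivisibleByFour.
Variables (k : nat) (k4 : (4 %| k.+1)%N).
Let C : finGroupType := 'I_k.+1.

Fact cyclic_power_subproof j :
  {in [set: C] &, {morph (fun x : C => x ^+ j)%g : x y / (x * y)%g}}.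
Proof. by move=> x y _ _; apply: expgMn; apply: Zp_mulgC. Qed.
Definition cyclic_power j := Morphism (cyclic_power_subproof j).

(** The constant tau is the invariant of the plane with rotation z.  The plane with
   rotation z^j is its pullback along the j-th power map, which multiplies the
   invariant by j; it counts in m exactly when j is odd, which is when half the
   order of the group acts by -1 on it.  Products of degree-1 classes contribute
   multiples of binom(k + 1, 2), an even number. *)
Lemma sw2_cyclic_gen (z : R[i]) : k.+1.-primitive_root z -> exists tau : 'F_2,
  forall rho : representation R [set: C], exists m,
  \tr (rho (Zp1 ^+ (k.+1)./2)%g) = (rdegree rho)%:R - 4%:R * m%:R /\
  eval_class (power_sum (Zp1 : C) k.+1) (sw W rho 2) = tau *+ m.
Proof.
move=> prz; have zk1 := prim_expr_order prz.
have ev : ~~ odd k.+1 by case/dvdnP: k4 => q ->; rewrite oddM andbF.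
have Zk : (Zp1 ^+ k.+1 = 1 :> C)%g by exact: Zp1_expg_order.
have d2 (b : cochain C 1) : power_sum (Zp1 : C) k.+1 (coboundary b) = 0.
  exact: power_sum_coboundary.
have [q k4q] : exists q, k.+1 = (4 * q)%N.
  by case/dvdnP: k4 => q; exists q; rewrite mulnC.
have halfk : (k.+1)./2 = (2 * q)%N by lia.
have bin2_even : ~~ odd 'C(k.+1, 2).
  have -> : 'C(k.+1, 2) = (2 * (q * k))%N by rewrite bin2 /= k4q; lia.
  by rewrite oddM.
have half_lt : ((k.+1)./2 < k.+1)%N by rewrite ltn_half_double -addnn; lia.
have halfE : (Zp1 ^+ (k.+1)./2 : C)%g = (k.+1)./2 :> nat.
  by rewrite Zp_expg /= modnMml mul1n modn_small.
exists (eval_class (power_sum (Zp1 : C) k.+1) (sw W (rotation_repr zk1) 2)) => rho.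
elim/cyclic_repr_ind: rho => [rho d0|rho sigma sim [m [trm w2m]]|a a1 rho|l l1 rho _].
- exists 0%N; rewrite sw_rank ?d0 // eval_class0 // mulr0 subr0; split=> //.
  by move: (rho _ : 'M[R]__); rewrite d0 => M; rewrite [M]flatmx0 mxtrace0.
- exists m; rewrite !(sw_iso W sim) (mxtrace_rsim sim) ?inE //.
  by rewrite (mxrank_rsim sim).
- case=> m [trm w2m]; exists m.
  rewrite mxtrace_dadd trm sw2_dadd !eval_classD // eval_power_sum_cup //.
  rewrite (@sw_rank _ _ _ (linear_repr a1) 2) // eval_class0 // addr0 w2m.
  rewrite [_ *+ 'C(_, _)]mulrn_even_F2 ?bin2_even // addr0; split=> //.
  rewrite /= halfE mxtrace_scalar mulr1n.
  (* A real root of unity is 1 or -1, and half the order is even. *)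
  have a2 : a ^+ 2 = 1.
    by apply/eqP; rewrite -(pexpr_eq1 (n := k.+1)) ?sqr_ge0 // exprAC a1 expr1n.
  by rewrite halfk exprM a2 expr1n natrD; ring.
- case=> m [trm w2m].
  have [j lE] := prim_rootP prz l1.
  have sim : mx_rsim (rotation_repr l1) (pull_repr (cyclic_power j) (rotation_repr zk1)).
    apply: eq_rsim => x; congr real_mx; rewrite /cyclic_char /= Zp_expg /=.
    by rewrite expr_mod // lE -exprM mulnC.
  have zh : z ^+ (k.+1)./2 = -1.
    have /eqP : (z ^+ (k.+1)./2) ^+ 2 = 1 by rewrite -exprM muln2 halfK (negPf ev) subn0.
    rewrite sqrf_eq1 => /orP[|/eqP //].
    rewrite -(prim_order_dvd prz) => /dvdn_leq; lia.
  have lh : l ^+ (k.+1)./2 = (- 1) ^+ odd j.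
    by rewrite lE exprAC zh signr_odd.
  exists (odd j + m)%N.
  rewrite mxtrace_dadd trm sw2_dadd !eval_classD // eval_power_sum_cup // w2m.
  rewrite [_ *+ 'C(_, _)]mulrn_even_F2 ?bin2_even // addr0 (sw_iso W sim) sw_natural.
  rewrite eval_power_sum_pull // [cyclic_power j _]/= eval_power_sumX //.
  split; last first.
    rewrite mulrnDr addrC; congr (_ + _).
    by rewrite -{1}(odd_double_half j) mulrnDr [_ *+ _.*2]mulrn_even_F2 ?odd_double ?addr0.
  rewrite /= /cyclic_char halfE lh /real_mx mxtrace_block !mxtrace_scalar !mulr1n.
  by rewrite !natrD; case: (odd j) => /=; ring.
Qed.

End OrderDivisibleByFour.

End StiefelWhitney.

(** * Commutators in GL_2 and diagonal matrices in GL_n *)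

Section TwoByTwo.
Variable F : fieldType.
Implicit Types a b c d : F.

Definition mx2 a b c d : 'M[F]_2 := \matrix_(i, j)
  if i == 0 then (if j == 0 then a else b) else (if j == 0 then c else d).

Lemma mul_mx2 a b c d a' b' c' d' : mx2 a b c d *m mx2 a' b' c' d' =
  mx2 (a * a' + b * c') (a * b' + b * d') (c * a' + d * c') (c * b' + d * d').
Proof.
apply/matrixP=> i j; rewrite !mxE !big_ord_recl big_ord0 !mxE /= addr0.
by case: (i == 0); case: (j == 0).
Qed.

Lemma scalar_mx2 a : a%:M = mx2 a 0 0 a.
Proof.
by apply/matrixP=> -[[|[|//]] lti] -[[|[|//]] ltj]; rewrite !mxE.
Qed.

Lemma mx2_unit a b c d : a * d - b * c != 0 -> mx2 a b c d \is a GRing.unit.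
Proof.
move=> D0; pose D := a * d - b * c.
have : mx2 a b c d *m mx2 (d / D) (- b / D) (- c / D) (a / D) = 1%:M.
  by rewrite mul_mx2 scalar_mx2; congr mx2; rewrite /D; field.
by case/mulmx1_unit.
Qed.

End TwoByTwo.

Section GL2.
Variable F : finFieldType.

Definition gl2 (a b c d : F) (D0 : a * d - b * c != 0) : {'GL_2[F]} :=
  FinRing.Unit (mx2_unit D0).

Lemma gl2_eqP (A B : {'GL_2[F]}) : GLval A = GLval B -> A = B.
Proof. exact: val_inj. Qed.

Lemma diag2l_neq0 (c : F) : c != 0 -> c * 1 - 0 * 0 != 0.
Proof. by rewrite mulr1 mulr0 subr0. Qed.

Lemma diag2r_neq0 (c : F) : c != 0 -> 1 * c - 0 * 0 != 0.
Proof. by rewrite mul1r mulr0 subr0. Qed.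

Definition diag2l c (c0 : c != 0) := gl2 (diag2l_neq0 c0).
Definition diag2r c (c0 : c != 0) := gl2 (diag2r_neq0 c0).

(** The swap P satisfies (diag(c, 1) P)^2 = c I, and it is a square: the matrix S with
   eigenvalues 1 and i on the eigenlines of P, where i^2 = -1, squares to P. *)
Lemma commutator_form_diag2_1mod4 (x : cohom {'GL_2[F]} 2) (i c : F) (c0 : c != 0) :
    i ^+ 2 = - 1 -> 2%:R != 0 :> F ->
  eval_class (commutator_form (diag2l c0) (diag2r c0)) x = 0.
Proof.
move=> i2 two0; have i2' : i * i = -1 by rewrite -expr2.
pose p := (1 + i) / 2%:R; pose q := (1 - i) / 2%:R.
have Sdet : p * p - q * q != 0.
  have -> : p * p - q * q = i by rewrite /p /q; field.
  by apply: contra_eqN i2 => /eqP ->; rewrite expr0n eq_sym oppr_eq0 oner_eq0.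
pose S := gl2 Sdet; pose a := diag2l c0.
have SS : GLval (S * S)%g = mx2 0 1 1 0.
  rewrite GL_ME; apply: (etrans (mul_mx2 _ _ _ _ _ _ _ _)).
  by congr mx2; rewrite /p /q; field: i2'.
have aSS : GLval (a * (S * S))%g = mx2 0 c 1 0.
  rewrite GL_ME SS; apply: (etrans (mul_mx2 _ _ _ _ _ _ _ _)); congr mx2; ring.
have zE : GLval ((a * (S * S)) ^+ 2)%g = c%:M.
  rewrite expg2 GL_ME aSS scalar_mx2.
  by apply: (etrans (mul_mx2 _ _ _ _ _ _ _ _)); congr mx2; ring.
have cz (y : {'GL_2[F]}) : commute y ((a * (S * S)) ^+ 2)%g.
  by apply: gl2_eqP; rewrite [LHS]GL_ME [RHS]GL_ME zE; apply: comm_mx_scalar.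
have := commutator_form_sqr x (cz S) (cz a).
suff -> : (a^-1 * (a * (S * S)) ^+ 2)%g = diag2r c0 by [].
apply: (mulgI a); rewrite mulKVg; apply: gl2_eqP; rewrite zE scalar_mx2 GL_ME.
by apply/esym/(etrans (mul_mx2 _ _ _ _ _ _ _ _)); congr mx2; ring.
Qed.

(** With a^2 + b^2 = -1, the matrices J = (0 -1; 1 0) and K = (a b; b -a)
   generate a quaternion group, and diag(-1, 1) inverts J. *)
Lemma commutator_form_diag2_sign (x : cohom {'GL_2[F]} 2) (a b : F)
    (c0 : - 1 != 0 :> F) : a ^+ 2 + b ^+ 2 = - 1 ->
  eval_class (commutator_form (diag2l c0) (diag2r c0)) x = 0.
Proof.
move=> ab; have ab' : a * a = - 1 - b * b.
  by rewrite -!expr2 -ab addrK.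
have Jdet : 0 * 0 - (-1) * 1 != 0 :> F.
  by rewrite mul0r mulr1 sub0r opprK oner_eq0.
have Kdet : a * - a - b * b != 0 by rewrite mulrN ab' opprB opprK [X in X - _]addrC addrK oner_eq0.
pose J := gl2 Jdet; pose K := gl2 Kdet; pose h := diag2l c0.
have JJ : GLval (J * J)%g = (-1)%:M.
  rewrite GL_ME scalar_mx2; apply: (etrans (mul_mx2 _ _ _ _ _ _ _ _)).
  by congr mx2; ring.
have KK : (J * J = K * K)%g.
  apply: gl2_eqP; rewrite JJ GL_ME scalar_mx2; apply: esym.
  by apply: (etrans (mul_mx2 _ _ _ _ _ _ _ _)); congr mx2; ring: ab'.
have J4 : (J * J * (J * J) = 1)%g.
  apply: gl2_eqP; rewrite GL_ME JJ GL_1E -[_ * _]/(_ *m _) -scalar_mxM.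
  by rewrite mulrNN mulr1.
have conj_inv (u v : {'GL_2[F]}) : (u * v * u = v)%g -> (u ^ v = u^-1)%g.
  move=> uvu; apply: (mulgI v); rewrite /conjg mulKVg.
  by apply: (mulIg u); rewrite uvu mulgKV.
have KJ : (K ^ J = K^-1)%g.
  apply: conj_inv; apply: gl2_eqP; rewrite !GL_ME.
  rewrite -![_ * _]/(_ *m _) [X in X *m _ = _]mul_mx2.
  by apply: (etrans (mul_mx2 _ _ _ _ _ _ _ _)); congr mx2; ring: ab'.
have Jh : (J ^ h = J^-1)%g.
  apply: conj_inv; apply: gl2_eqP; rewrite !GL_ME.
  rewrite -![_ * _]/(_ *m _) [X in X *m _ = _]mul_mx2.
  by apply: (etrans (mul_mx2 _ _ _ _ _ _ _ _)); congr mx2; ring.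
have := commutator_form_quaternion x KK KJ Jh J4.
suff -> : (h^-1 * (J * J))%g = diag2r c0 by [].
apply: (mulgI h); rewrite mulKVg; apply: gl2_eqP; rewrite JJ scalar_mx2 GL_ME.
by apply/esym/(etrans (mul_mx2 _ _ _ _ _ _ _ _)); congr mx2; ring.
Qed.

(** There are more than q / 2 squares, so the squares meet the values of
   -1 - b^2. *)
Lemma sum_two_squares_N1 : odd #|F| -> exists a b : F, a ^+ 2 + b ^+ 2 = - 1.
Proof.
move=> oddF; pose A := [set x ^+ 2 | x in [set: F]].
pose root (y : F) := odflt 0 [pick x | x ^+ 2 == y].
have rootK x : root (x ^+ 2) = x \/ root (x ^+ 2) = - x.
  rewrite /root; case: pickP => [y|/(_ x)]; last by rewrite eqxx.
  by rewrite eqf_sqr => /orP[] /eqP ->; [left | right].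
pose U := root @: A; pose V := [set - root y | y in A].
have cardUV : (#|F| < #|A| + #|A|)%N.
  have UV : U :|: V = [set: F].
    apply/setP=> x; rewrite !inE; apply/orP.
    have Ax : x ^+ 2 \in A by apply: imset_f.
    case: (rootK x) => e; [left | right]; apply/imsetP; exists (x ^+ 2) => //.
    by rewrite e opprK.
  have UV0 : (0 < #|U :&: V|)%N.
    have A0 : 0 \in A by apply/imsetP; exists 0; rewrite ?expr0n ?inE.
    have root0 : root 0 = 0.
      by have := rootK 0; rewrite expr0n oppr0 /= => -[].
    apply/card_gt0P; exists 0; rewrite inE.
    by apply/andP; split; apply/imsetP; exists 0; rewrite ?root0 ?oppr0.
  have := cardsUI U V; rewrite UV cardsT => e.
  have leU : (#|U| <= #|A|)%N by apply: leq_imset_card.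
  have leV : (#|V| <= #|A|)%N by apply: leq_imset_card.
  apply: (@leq_trans (#|F| + #|U :&: V|)); first by rewrite -addn1 leq_add2l.
  by rewrite e leq_add.
pose B := [set - 1 - y | y in A].
have cardB : #|B| = #|A| by apply: card_imset => y z /addrI /oppr_inj.
have [e | [y]] := set_0Vmem (A :&: B).
  have := cardsUI A B; rewrite e cards0 cardB addn0 => e'.
  by have := max_card (mem (A :|: B)); rewrite e' leqNgt cardUV.
rewrite inE => /andP[/imsetP[a _ ->] /imsetP[_ /imsetP[b _ ->] e]].
by exists a, b; rewrite e subrK.
Qed.

End GL2.

Section Embedding.
Variables (F : finFieldType) (n : nat) (i j : 'I_n.+1).
Hypothesis ne_ij : i != j.

Let B : 'M[F]_(2, n.+1) :=
  \matrix_(a, b) ((if a == 0 then i else j) == b)%:R.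

Let BBt : B *m B^T = 1%:M.
Proof.
apply/matrixP=> a b; rewrite !mxE.
rewrite (bigD1 (if a == 0 then i else j)) //= big1 ?addr0; last first.
  by move=> k ne_k; rewrite !mxE eq_sym (negPf ne_k) mul0r.
rewrite !mxE eqxx mul1r.
have ji := ne_ij; rewrite eq_sym in ji.
by case: a b => [[|[|//]] lta] [[|[|//]] ltb] /=; rewrite ?eqxx ?(negPf ji) ?(negPf ne_ij).
Qed.

(** The block inclusion of GL_2 acting on the coordinates i and j, written without
   case distinctions: B is a coisometry, so this is multiplicative in A. *)
Definition embed_mx (A : 'M[F]_2) : 'M[F]_n.+1 := 1%:M + B^T *m (A - 1%:M) *m B.

Lemma embed_mxM A A' : embed_mx (A *m A') = embed_mx A *m embed_mx A'.
Proof.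
pose X := A - 1%:M; pose Y := A' - 1%:M.
have -> : A *m A' = 1%:M + (X + Y + X *m Y).
  rewrite /X /Y mulmxBl mulmxBr mulmx1 mul1mx opprB !addrA.
  by apply/matrixP=> a b; rewrite !mxE; ring.
rewrite /embed_mx -/X -/Y [1%:M + _ - _]addrC addKr.
move: X Y => X Y; rewrite [RHS]mulmxDr mulmx1.
rewrite [X in _ = _ + X]mulmxDl mul1mx !mulmxDr !mulmxDl !addrA.
by rewrite !mulmxA -[_ *m B *m B^T]mulmxA BBt mulmx1.
Qed.

Lemma embed_mx1 : embed_mx 1%:M = 1%:M.
Proof. by rewrite /embed_mx subrr mulmx0 mul0mx addr0. Qed.

Fact embed_subproof (A : {'GL_2[F]}) : embed_mx (GLval A) \is a GRing.unit.
Proof.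
have : embed_mx (GLval A) *m embed_mx (GLval A^-1%g) = 1%:M.
  rewrite -embed_mxM -[RHS]embed_mx1; congr embed_mx.
  by have := GL_ME A A^-1; rewrite mulgV GL_1E.
by case/mulmx1_unit.
Qed.

Definition embedGL (A : {'GL_2[F]}) : {'GL_n.+1[F]} :=
  FinRing.Unit (embed_subproof A).

Fact embedGLM : {in [set: {'GL_2[F]}] &, {morph embedGL : A A' / (A * A')%g}}.
Proof. by move=> A A' _ _; apply: val_inj; exact: embed_mxM. Qed.

Definition embedGL_morphism := Morphism embedGLM.

Lemma embed_mx_diag a d : embed_mx (mx2 a 0 0 d) =
  diag_mx (\row_k if k == i then a else if k == j then d else 1).
Proof.
apply/matrixP=> k l; rewrite !mxE !big_ord_recl big_ord0 !mxE /=.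
rewrite !big_ord_recl !big_ord0 !mxE /= ?mulr1n ?mulr0n ?subrr ?subr0.
rewrite !mulr0 ?add0r !addr0.
rewrite [k == i]eq_sym [k == j]eq_sym.
have [<-|ne_kl] := eqVneq k l.
  have [<-|_] := eqVneq i k; first by rewrite [j == i]eq_sym (negPf ne_ij) /=; ring.
  by case: (j == k); rewrite ?mulr1n ?mulr0n; ring.
have z p e : (p == k)%:R * e * (p == l)%:R = 0 :> F.
  by have [->|] := eqVneq p k; rewrite ?(negPf ne_kl) ?mulr0 // mul0r mul0r.
by rewrite !z !addr0 mulr0n.
Qed.

End Embedding.

Section EntryGL.
Variables (F : finFieldType) (n : nat).
Implicit Types (i j : 'I_n.+1) (u : {unit F}).

Definition entry_row i (c : F) : 'rV[F]_n.+1 := \row_k if k == i then c else 1.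

Fact entry_subproof i u : diag_mx (entry_row i (val u)) \is a GRing.unit.
Proof.
rewrite -[_ \is a _]/(_ \in unitmx) unitmxE det_diag unitfE.
apply/prodf_neq0 => j _; rewrite mxE; case: ifP; rewrite ?oner_eq0 // -unitfE.
by move=> _; exact: (valP u).
Qed.

Definition entryGL i u : {'GL_n.+1[F]} := FinRing.Unit (entry_subproof i u).

Lemma entryGL_diag i u : entryGL i u \in diagGL F n.
Proof. by rewrite inE; exact: diag_mx_is_diag. Qed.

Lemma entryGLE i u k : GLval (entryGL i u) k k = if k == i then val u else 1.
Proof. by rewrite mxE eqxx mulr1n mxE. Qed.

Lemma diagGL_eqP (A B : {'GL_n.+1[F]}) : A \in diagGL F n -> B \in diagGL F n ->
  (forall k, GLval A k k = GLval B k k) -> A = B.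
Proof.
rewrite !inE => /is_diag_mxP dA /is_diag_mxP dB e; apply: val_inj.
apply/matrixP=> k l; have [<-|ne_kl] := eqVneq k l; first exact: e.
by rewrite [LHS]dA // [RHS]dB.
Qed.

Lemma entryGLM i u u' : entryGL i (u * u')%g = (entryGL i u * entryGL i u')%g.
Proof.
apply: diagGL_eqP; rewrite ?(groupM (G := diagGL_group F n)) ?entryGL_diag //.
move=> k; rewrite diagGLM ?entryGL_diag // !entryGLE.
by case: eqP => _; rewrite ?mulr1.
Qed.

Lemma entryGLX i u m : entryGL i (u ^+ m)%g = (entryGL i u ^+ m)%g.
Proof.
elim: m => [|m IHm]; last by rewrite !expgS entryGLM IHm.
apply: diagGL_eqP; rewrite ?(group1 (diagGL_group F n)) ?entryGL_diag //.
by move=> k; rewrite entryGLE GL_1E mxE eqxx; case: eqP.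
Qed.

Lemma diagGLC (A B : {'GL_n.+1[F]}) : A \in diagGL F n -> B \in diagGL F n ->
  commute A B.
Proof.
move=> dA dB; apply: diagGL_eqP; rewrite ?(groupM (G := diagGL_group F n)) //.
by move=> k; rewrite !diagGLM // mulrC.
Qed.

Lemma diagGL_prod_entry (A : {'GL_n.+1[F]}) (u : 'I_n.+1 -> {unit F}) :
    A \in diagGL F n -> (forall k, GLval A k k = val (u k)) ->
  A = (\prod_k entryGL k (u k))%g.
Proof.
move=> dA Au.
have prodE (r : seq 'I_n.+1) :
    (\prod_(k <- r) entryGL k (u k))%g \in diagGL F n /\
    forall l, GLval (\prod_(k <- r) entryGL k (u k))%g l l =
              \prod_(k <- r) (if l == k then val (u k) else 1).
  elim: r => [|k r [IHd IHr]].
    rewrite !big_nil (group1 (diagGL_group F n)); split=> // l.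
    by rewrite big_nil GL_1E mxE eqxx.
  rewrite big_cons (groupM (G := diagGL_group F n)) ?entryGL_diag //; split=> // l.
  by rewrite big_cons diagGLM ?entryGL_diag // entryGLE IHr.
have [dP EP] := prodE (index_enum _).
apply: diagGL_eqP => // k; rewrite EP Au (bigD1 k) //= eqxx big1 ?mulr1 // => l.
by rewrite eq_sym => /negPf ->.
Qed.

(** The two diagonal matrices are the images of diag(c, 1) and diag(1, c) under the
   block inclusion of GL_2 at i and j. *)
Lemma commutator_form_entry (x : cohom {'GL_n.+1[F]} 2) i j u : i != j ->
    (forall (y : cohom {'GL_2[F]} 2) (u0 : val u != 0),
       eval_class (commutator_form (diag2l u0) (diag2r u0)) y = 0) ->
  eval_class (commutator_form (entryGL i u) (entryGL j u)) x = 0.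
Proof.
move=> ne_ij y0; have u0 : val u != 0 by rewrite -unitfE; exact: (valP u).
have cd : commute (diag2l u0) (diag2r u0).
  by apply: gl2_eqP; rewrite !GL_ME; apply/(etrans (mul_mx2 _ _ _ _ _ _ _ _));
     apply/esym/(etrans (mul_mx2 _ _ _ _ _ _ _ _)); congr mx2; ring.
have := y0 (pull (embedGL_morphism F ne_ij) x) u0.
rewrite eval_commutator_pull //=.
have -> : embedGL ne_ij (diag2l u0) = entryGL i u.
  apply: val_inj; rewrite /= embed_mx_diag //; congr diag_mx.
  apply/rowP=> k.
  by rewrite !mxE; case: (k == i) => //; rewrite if_same.
have -> : embedGL ne_ij (diag2r u0) = entryGL j u.
  apply: val_inj; rewrite /= embed_mx_diag //; congr diag_mx.
  apply/rowP=> k.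
  by rewrite !mxE; case: (k =P i) => // ->; rewrite (negPf ne_ij).
by [].
Qed.

Lemma entryGL_conj i j u : exists s, entryGL j u = (entryGL i u ^ s)%g.
Proof.
have Us : perm_mx (tperm i j) \is a GRing.unit := @unitmx_perm F n.+1 (tperm i j).
exists (FinRing.Unit Us : {'GL_n.+1[F]}); set s := FinRing.Unit _.
apply: (mulgI s); rewrite /conjg mulKVg; apply: val_inj.
apply: (@etrans _ _ (perm_mx (tperm i j) *m diag_mx (entry_row j (val u)))) => //.
apply: (@etrans _ _ (diag_mx (entry_row i (val u)) *m perm_mx (tperm i j))) => //.
rewrite mul_mx_diag mul_diag_mx; apply/matrixP=> k l; rewrite !mxE.
case: eqP => [<-|_]; last by rewrite mul0r mulr0.
by rewrite -{2}(tpermL i j) (inj_eq perm_inj) mulrC.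
Qed.

End EntryGL.

(** * Restriction to cyclic subgroups and the characters of the torus *)

Section CyclicSubgroups.
Variables (k : nat) (gT : finGroupType) (h : gT).
Hypothesis hk1 : (h ^+ k.+1 = 1)%g.

Fact cyclic_subproof :
  {in [set: 'I_k.+1] &, {morph (fun x : 'I_k.+1 => h ^+ x)%g : x y / (x * y)%g}}.
Proof. by move=> x y _ _; rewrite Zp_mulgE expg_mod // expgD. Qed.
Definition cyclic_morphism := Morphism cyclic_subproof.

Lemma cyclic_morphism_gen : cyclic_morphism Zp1 = h.
Proof. by rewrite /= expg_mod // expg1. Qed.

End CyclicSubgroups.

Section Restriction.
Variables (R : realType) (W : SW_theory R).

Lemma sw_involution (gT : finGroupType) (rho : representation R [set: gT]) (h : gT) :
  (h ^+ 2 = 1)%g -> exists m,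
  [/\ \tr (rho h) = (rdegree rho)%:R - 2%:R * m%:R,
      eval_class (at1 h) (sw W rho 1) = m%:R &
      eval_class (power_sum h 2) (sw W rho 2) = 'C(m, 2)%:R].
Proof.
move=> h2; pose f := cyclic_morphism h2.
have [m] := sw_order_two W (pull_repr f rho).
rewrite !sw_natural eval_at1_pull eval_power_sum_pull //; last exact: Zp1_expg_order.
by rewrite [pull_repr _ _ _]/= expg1 => -[]; exists m.
Qed.

(** The constant tau is common to all groups and representations, so that it can be
   compared between pi and the characters of the torus. *)
Lemma sw2_cyclic (k : nat) (z : R[i]) : (4 %| k.+1)%N ->
  k.+1.-primitive_root z -> exists tau : 'F_2,
  forall (gT : finGroupType) (rho : representation R [set: gT]) (h : gT),
  (h ^+ k.+1 = 1)%g -> exists m,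
  \tr (rho (h ^+ (k.+1)./2)%g) = (rdegree rho)%:R - 4%:R * m%:R /\
  eval_class (power_sum h k.+1) (sw W rho 2) = tau *+ m.
Proof.
move=> k4 prz; have [tau tauP] := sw2_cyclic_gen W k4 prz.
exists tau => gT rho h hk; pose f := cyclic_morphism hk.
have ev : ~~ odd k.+1 by case/dvdnP: k4 => q ->; rewrite oddM andbF.
have [m] := tauP (pull_repr f rho).
rewrite !sw_natural eval_power_sum_pull //; last exact: Zp1_expg_order.
rewrite cyclic_morphism_gen => -[trm w2m]; exists m; split=> //.
rewrite -trm [pull_repr _ _ _]/= -[h in LHS](cyclic_morphism_gen hk).
by rewrite -morphX ?inE.
Qed.

End Restriction.

Section Commutators.
Variable gT : finGroupType.
Implicit Types (a b : gT) (x : cohom gT 2).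

Lemma eval_commutatorxx a x : eval_class (commutator_form a a) x = 0.
Proof. exact: subrr. Qed.

Lemma eval_commutator1l b x : eval_class (commutator_form 1%g b) x = 0.
Proof.
by rewrite /eval_class /= /commutator_form cocycle2_1l cocycle2_1r subrr.
Qed.

Lemma eval_commutator1r a x : eval_class (commutator_form a 1%g) x = 0.
Proof.
by rewrite /eval_class /= /commutator_form cocycle2_1l cocycle2_1r subrr.
Qed.

Lemma eval_classB k (ell : {additive cochain gT k.+1 -> 'F_2})
    (x y : cohom gT k.+1) :
  (forall b : cochain gT k, ell (coboundary b) = 0) ->
  eval_class ell (x - y) = eval_class ell x - eval_class ell y.
Proof. by move=> d0; exact: eval_class_is_additive. Qed.

End Commutators.

Section Subgroup.
Variables (gT : finGroupType) (G : {group gT}).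

Lemma sgval_prod I (r : seq I) (u : I -> subg_of G) :
  sgval (\prod_(i <- r) u i)%g = (\prod_(i <- r) sgval (u i))%g.
Proof. exact: (big_morph sgval). Qed.

Lemma sgvalX (u : subg_of G) m : sgval (u ^+ m)%g = (sgval u ^+ m)%g.
Proof. by elim: m => // m IHm; rewrite !expgS -IHm. Qed.

End Subgroup.

Section OddField.
Variables (F : finFieldType) (g : {unit F}).
Hypotheses (oddF : odd #|F|) (hg : generator [set: {unit F}] g).

Lemma order_gen : #[g]%g = #|F|.-1.
Proof. by rewrite orderE -(eqP hg) card_finField_unit. Qed.

Lemma card_odd_gt2 : (2 < #|F|)%N.
Proof. by move: (finNzRing_gt1 F) oddF; case: #|F| => [|[|[|]]]. Qed.

Lemma gen_half_sqr : val (g ^+ (#|F|.-1)./2)%g ^+ 2 = 1 :> F.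
Proof.
have -> : val (g ^+ (#|F|.-1)./2)%g ^+ 2 = val ((g ^+ (#|F|.-1)./2) ^+ 2)%g.
  by rewrite expg2 FinRing.val_unitM.
rewrite -expgM muln2 halfK -order_gen.
have -> : odd #[g]%g = false by rewrite order_gen; move: oddF card_odd_gt2; lia.
by rewrite subn0 expg_order.
Qed.

Lemma gen_half : val (g ^+ (#|F|.-1)./2)%g = - 1 :> F.
Proof.
move/eqP: gen_half_sqr; rewrite sqrf_eq1 => /orP[/eqP e|/eqP //].
have /eqP : (g ^+ (#|F|.-1)./2 = 1)%g by apply: val_inj.
rewrite -order_dvdn order_gen => /dvdn_leq; move: oddF card_odd_gt2; lia.
Qed.

Lemma oppr1_neq1 : - 1 != 1 :> F.
Proof.
apply/eqP=> e; have /eqP : (g ^+ (#|F|.-1)./2 = 1)%g.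
  by apply: val_inj; rewrite gen_half e.
rewrite -order_dvdn order_gen => /dvdn_leq; move: oddF card_odd_gt2; lia.
Qed.

Lemma two_neq0 : 2%:R != 0 :> F.
Proof.
apply: contraNneq oppr1_neq1 => e.
by apply/eqP/esym/eqP; rewrite -addr_eq0 -(natrD _ 1 1) e.
Qed.

End OddField.

Section Torus.
Variables (R : realType) (W : SW_theory R) (F : finFieldType) (n : nat).
Variables (g : {unit F}) (z : R[i]).
Hypotheses (hg : generator [set: {unit F}] g)
  (hz : (#|F|.-1).-primitive_root z).

Fact entry_unit_subproof (i : 'I_n.+1) (A : subg_of (diagGL_group F n)) :
  GLval (sgval A) i i \is a GRing.unit.
Proof. by rewrite unitfE; apply: diagGL_neq0; exact: subgP. Qed.

Definition entry_unit i A : {unit F} := FinRing.Unit (entry_unit_subproof i A).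

Fact entry_unitM i : {in [set: subg_of (diagGL_group F n)] &,
  {morph entry_unit i : A A' / (A * A')%g}}.
Proof. by move=> A A' _ _; apply: val_inj; apply: diagGLM; exact: subgP. Qed.

Definition entry_morphism i := Morphism (entry_unitM i).

Definition unit_char (u : {unit F}) : R[i] := z ^+ dlog g (val u).

Lemma dlog_val (u : {unit F}) : (g ^+ dlog g (val u))%g = u.
Proof. by apply: val_inj; rewrite dlogK // -unitfE; exact: (valP u). Qed.

Fact unit_char1 : unit_char 1%g = 1.
Proof. by rewrite -(expr0 z); apply: (expr_dlog hg hz); rewrite dlog_val. Qed.

Fact unit_charM : {morph unit_char : u v / (u * v)%g >-> u * v}.
Proof.
move=> u v; rewrite /unit_char -exprD; apply: (expr_dlog hg hz).
by rewrite expgD !dlog_val.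
Qed.

(** The i-th character of the torus is pulled back along the i-th entry, which
   kills the factors of the torus in other positions. *)
Lemma commutator_torus (i j l : 'I_n.+1) (A B : subg_of (diagGL_group F n)) :
    commute A B -> sgval A = entryGL i g -> sgval B = entryGL j g -> i != j ->
  eval_class (commutator_form A B) (sw W (torus_repr hg hz l) 2) = 0.
Proof.
move=> cAB Ai Bj ne_ij.
have sim : mx_rsim (torus_repr hg hz l)
    (pull_repr (entry_morphism l) (real_of_char unit_char1 unit_charM)).
  by apply: eq_rsim.
rewrite (sw_iso W sim) sw_natural eval_commutator_pull //=.
have [e|ne_li] := eqVneq l i.
  have -> : entry_unit l B = 1%g; last exact: eval_commutator1r.
  by apply: val_inj; rewrite -[LHS]/(GLval (sgval B) l l) Bj entryGLE e (negPf ne_ij).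
have -> : entry_unit l A = 1%g; last exact: eval_commutator1l.
by apply: val_inj; rewrite -[LHS]/(GLval (sgval A) l l) Ai entryGLE (negPf ne_li).
Qed.

End Torus.

(** * The second Stiefel-Whitney class on the diagonal subgroups *)

Section Main.
Variables (R : realType) (W : SW_theory R) (F : finFieldType) (n : nat).
Hypothesis oddF : odd #|F|.
Variable g : {unit F}.
Hypothesis hg : generator [set: {unit F}] g.
Variable rho : representation R [set: {'GL_n.+1[F]}].

Let N1 := (g ^+ (#|F|.-1)./2)%g.

Let N1E : val N1 = - 1 :> F.
Proof. exact: gen_half. Qed.

Lemma h1E : h1 F n = entryGL ord0 N1.
Proof.
apply: val_inj; rewrite /= -/(val N1) N1E; congr diag_mx.
Qed.

Lemma mxtrace_entry (i : 'I_n.+1) : \tr (rho (entryGL i N1)) = \tr (rho (h1 F n)).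
Proof.
have [s ->] := entryGL_conj ord0 i N1.
rewrite -h1E /conjg !repr_mxM ?inE // mxtrace_mulC -mulmxA -repr_mxM ?inE //.
by rewrite mulgV repr_mx1 mulmx1.
Qed.

Lemma entryN1_sqr (i : 'I_n.+1) : (entryGL i N1 ^+ 2 = 1)%g.
Proof.
rewrite -entryGLX (_ : N1 ^+ 2 = 1)%g; last first.
  by apply: val_inj; rewrite expg2 FinRing.val_unitM N1E mulrNN mulr1.
by rewrite -(expg0 g) entryGLX.
Qed.

Lemma eq_coef_natr (m m' : nat) (d t c : R) : c != 0 ->
  t = d - c * m%:R -> t = d - c * m'%:R -> m = m'.
Proof.
move=> c0 -> /addrI /oppr_inj /(mulfI c0) /eqP.
by rewrite eqr_nat => /eqP.
Qed.

Section Sign.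
Variable m : nat.
Hypothesis trm : \tr (rho (h1 F n)) = (rdegree rho)%:R - 2%:R * m%:R.

Let D := signGL_group F n.

Fact entryN1_sign (i : 'I_n.+1) : entryGL i N1 \in D.
Proof.
rewrite inE entryGL_diag; apply/forallP=> k; rewrite entryGLE N1E.
by case: (k == i); rewrite eqxx ?orbT.
Qed.

Let h (i : 'I_n.+1) : subg_of D := Subg (entryN1_sign i).
Let v (i : 'I_n.+1) := sw W (sign_char F R i) 1.

Let sgval_h i : sgval (h i) = entryGL i N1.
Proof. by []. Qed.

Let hX i : (h i ^+ 2 = 1)%g.
Proof. by apply: subg_inj; rewrite sgvalX; exact: entryN1_sqr. Qed.

Let subD (u : subg_of D) : sgval u \in diagGL F n.
Proof. by have := subgP u; rewrite inE => /andP[]. Qed.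

Let commD (u w : subg_of D) : commute u w.
Proof. by apply: subg_inj; apply: diagGLC. Qed.

(** The restriction of the j-th sign character to the i-th factor is the sign if
   i = j and is trivial otherwise. *)
Lemma at1_sign_char i j : eval_class (at1 (h i)) (v j) = (i == j)%:R.
Proof.
have [mij [tr -> _]] := sw_involution W (sign_char F R j) (hX i).
congr _%:R; apply: (eq_coef_natr (t := \tr (sign_char F R j (h i))) (c := 2%:R)) tr _.
  by rewrite pnatr_eq0.
rewrite /= mxtrace_scalar !mxE eqxx !mulr1n -[FinRing.uval N1]/(val N1) N1E [j == i]eq_sym.
case: (i == j); last by rewrite eqxx mulr0 subr0.
by rewrite (negPf (oppr1_neq1 oddF hg)) /= mulr1n; ring.
Qed.

(** Each generator has power invariant binom(m, 2) on both sides: on the left the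
   involutions are conjugate to h_1, on the right only v_i^2 sees the i-th one. *)
Lemma sw2_sign : sw W (res_repr rho D) 2 =
  (\sum_i @cup _ 1 1 2 erefl (v i) (v i)) *+ 'C(m, 2).
Proof.
have d2 i (b : cochain (subg_of D) 1) : power_sum (h i) 2 (coboundary b) = 0.
  exact: power_sum_coboundary.
have dc i j (b : cochain (subg_of D) 1) :
    commutator_form (h i) (h j) (coboundary b) = 0.
  exact: commutator_form_coboundary.
apply: subr0_eq.
apply: (@cohom2_eq0 _ _ (index_enum 'I_n.+1) h 2
  (fun i u => (GLval (sgval u) i i != 1))) => //.
- move=> u; apply: subg_inj; rewrite sgval_prod.
  rewrite [LHS](diagGL_prod_entry (u := fun i => N1 ^+ (GLval (sgval u) i i != 1)%R)%g) //.
    by apply: eq_bigr => i _; rewrite sgvalX sgval_h -entryGLX.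
  move=> i; have := subgP u; rewrite inE => /andP[_ /forallP/(_ i)].
  case: eqP => [-> _ //|_ /= /eqP ->].
  exact: (esym N1E).
- move=> i u w; rewrite diagGLM //.
  have n11 := oppr1_neq1 oddF hg.
  have signE (y : subg_of D) : (GLval (sgval y) i i == 1) || (GLval (sgval y) i i == -1).
    by have := subgP y; rewrite inE => /andP[_ /forallP/(_ i)].
  by case/orP: (signE u) => /eqP ->; case/orP: (signE w) => /eqP ->;
    rewrite ?mulr1 ?mul1r ?mulrNN ?mulr1 ?eqxx ?n11.
- move=> i; rewrite (eval_classB _ _ (d2 i)).
  rewrite sw_natural eval_power_sum_pull //.
  have [mi [tr _ ->]] := sw_involution W rho (entryN1_sqr i).
  have -> : mi = m.
    apply: (eq_coef_natr _ tr); first by rewrite pnatr_eq0.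
    by rewrite mxtrace_entry.
  rewrite (eval_class_mulrn (d2 i)) (eval_class_sum (d2 i)) (bigD1 i) // big1.
    by rewrite eval_power_sum_cup // at1_sign_char eqxx /= addr0 mulr1 binn subrr.
  move=> j /andP[_ ne_ji]; rewrite eval_power_sum_cup // at1_sign_char eq_sym.
  by rewrite (negPf ne_ji) mul0r mul0rn.
- move=> i j; have [->|ne_ij] := eqVneq i j; first exact: eval_commutatorxx.
  rewrite (eval_classB _ _ (dc i j)).
  have lift0 : eval_class (commutator_form (entryGL i N1) (entryGL j N1))
      (sw W rho 2) = 0.
    apply: commutator_form_entry => // y; rewrite N1E => u0.
    have [a [b ab]] := sum_two_squares_N1 oddF.
    exact: commutator_form_diag2_sign ab.
  rewrite sw_natural eval_commutator_pull // [X in X - _]lift0 sub0r.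
  rewrite (eval_class_mulrn (dc i j)) (eval_class_sum (dc i j)) big1 ?mul0rn ?oppr0 // => l _.
  by rewrite eval_commutator_cup // mulrC subrr.
Qed.

End Sign.

Section DiagonalTorus.
Variable m : nat.
Hypothesis trm : \tr (rho (h1 F n)) = (rdegree rho)%:R - 2%:R * m%:R.
Hypothesis q1 : (#|F| = 1 %[mod 4])%N.
Variable z : R[i].
Hypothesis hz : (#|F|.-1).-primitive_root z.

Let D := diagGL_group F n.
Let h (i : 'I_n.+1) : subg_of D := Subg (entryGL_diag i g).
Let t (i : 'I_n.+1) := sw W (torus_repr hg hz i) 2.

Let sgval_h i : sgval (h i) = entryGL i g.
Proof. by []. Qed.

Let entry_order (i : 'I_n.+1) : (entryGL i g ^+ #|F|.-1 = 1)%g.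
Proof. by rewrite -entryGLX -(order_gen hg) expg_order -(expg0 g) entryGLX. Qed.

Let hX i : (h i ^+ #|F|.-1 = 1)%g.
Proof. by apply: subg_inj; rewrite sgvalX; exact: entry_order. Qed.

Let commD (u w : subg_of D) : commute u w.
Proof. by apply: subg_inj; apply: diagGLC; exact: subgP. Qed.

Let four_dvd : (4 %| #|F|.-1)%N.
Proof.
by rewrite (divn_eq #|F| 4) q1 addn1 dvdn_mull.
Qed.

Let pred_even : ~~ odd #|F|.-1.
Proof. by case/dvdnP: four_dvd => q ->; rewrite oddM andbF. Qed.

Lemma sqrtN1 : exists i : F, i ^+ 2 = - 1.
Proof.
exists (val (g ^+ (#|F|.-1 %/ 4))%g).
transitivity (val ((g ^+ (#|F|.-1 %/ 4)) ^+ 2)%g).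
  by rewrite expg2 FinRing.val_unitM.
rewrite -expgM -[RHS]N1E /N1; congr (val (g ^+ _)%g).
by case/dvdnP: four_dvd => q ->; rewrite mulnK //; lia.
Qed.

(** The power of the i-th generator by half its order is the diagonal matrix with -1
   at i, on which the j-th character is -1 if i = j, and 1 otherwise. *)
Lemma mxtrace_torus i j : \tr (torus_repr hg hz j (h i ^+ (#|F|.-1)./2)%g) =
  2%:R - 4%:R * (i == j)%:R.
Proof.
have -> : torus_repr hg hz j (h i ^+ (#|F|.-1)./2)%g =
    real_mx (if i == j then - 1 else 1).
  rewrite /=; congr real_mx.
  rewrite /torus_char sgvalX sgval_h -entryGLX entryGLE eq_sym.
  case: (i == j).
    have zh : z ^+ (#|F|.-1)./2 = - 1.
      have /eqP : (z ^+ (#|F|.-1)./2) ^+ 2 = 1.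
        by rewrite -exprM muln2 halfK (negPf pred_even) subn0 prim_expr_order.
      rewrite sqrf_eq1 => /orP[|/eqP //].
      rewrite -(prim_order_dvd hz) => /dvdn_leq.
      by move: (card_odd_gt2 oddF); lia.
    by rewrite -zh; apply: (expr_dlog hg hz); exact: dlog_val.
  by rewrite -(expr0 z); apply: (expr_dlog hg hz); apply: (dlog_val hg 1%g).
rewrite /real_mx mxtrace_block !mxtrace_scalar.
by case: (i == j); rewrite /= ?mulr1n ?mulr0n; ring.
Qed.

(** Each generator has power invariant tau m / 2 on both sides.  The trace of h_1
   determines m, and [sw2_cyclic] writes the same trace with 4 m' instead of 2 m;
   hence m is even. *)
Lemma sw2_torus : ~~ odd m /\
  sw W (res_repr rho D) 2 = (\sum_i t i) *+ m./2.
Proof.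
have [k kE] : exists k, #|F|.-1 = k.+1.
  by exists #|F|.-2; have := card_odd_gt2 oddF; case: #|F| => [|[]].
have prz := hz; rewrite kE in prz.
have k4 := four_dvd; rewrite kE in k4.
have [tau] := sw2_cyclic W k4 prz; rewrite -kE => tauP.
have n4 : 4%:R != 0 :> R by rewrite pnatr_eq0.
have mE i : exists2 m', m = (2 * m')%N &
    eval_class (power_sum (entryGL i g) #|F|.-1) (sw W rho 2) = tau *+ m'.
  have [m' [tr e]] := tauP _ rho _ (entry_order i); exists m' => //.
  move: tr; rewrite -entryGLX mxtrace_entry trm => /addrI /oppr_inj.
  rewrite -[4%:R]/((2 * 2)%:R) natrM -mulrA => /(mulfI _).
  rewrite pnatr_eq0 -natrM => /(_ isT) /eqP.
  by rewrite eqr_nat => /eqP.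
have m_even : ~~ odd m by have [m' -> _] := mE ord0; rewrite oddM.
split=> //.
have d2 i (b : cochain (subg_of D) 1) :
    power_sum (h i) #|F|.-1 (coboundary b) = 0.
  exact: power_sum_coboundary.
have dc i j (b : cochain (subg_of D) 1) :
    commutator_form (h i) (h j) (coboundary b) = 0.
  exact: commutator_form_coboundary.
have powt i j : eval_class (power_sum (h i) #|F|.-1) (t j) = tau *+ (i == j).
  have [mij [tr ->]] := tauP _ (torus_repr hg hz j) _ (hX i).
  congr (_ *+ _); apply: (eq_coef_natr n4 tr).
  by rewrite mxtrace_torus.
apply: subr0_eq.
apply: (@cohom2_eq0 _ _ (index_enum 'I_n.+1) h #|F|.-1
  (fun i u => dlog g (GLval (sgval u) i i))) => //.
- move=> u; apply: subg_inj; rewrite sgval_prod.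
  rewrite [LHS](diagGL_prod_entry (u := fun i => entry_unit i u)) //; last exact: subgP.
  by apply: eq_bigr => i _; rewrite sgvalX sgval_h -entryGLX (dlog_val hg (entry_unit i u)).
- move=> i u w; apply/eqP; rewrite -(order_gen hg) -eq_expg_mod_order expgD.
  rewrite (dlog_val hg (entry_unit i u)) (dlog_val hg (entry_unit i w)).
  by rewrite (dlog_val hg (entry_unit i (u * w)%g)) entry_unitM ?inE.
- move=> i; rewrite (eval_classB _ _ (d2 i)).
  rewrite sw_natural eval_power_sum_pull //.
  have [m' mm' e] := mE i; rewrite [X in X - _]e.
  rewrite (eval_class_mulrn (d2 i)) (eval_class_sum (d2 i)) (bigD1 i) // big1.
    by rewrite powt eqxx /= addr0 mm' mul2n doubleK subrr.
  by move=> j /andP[_ ne_ji]; rewrite powt eq_sym (negPf ne_ji).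
- move=> i j; have [->|ne_ij] := eqVneq i j; first exact: eval_commutatorxx.
  rewrite (eval_classB _ _ (dc i j)).
  have lift0 : eval_class (commutator_form (entryGL i g) (entryGL j g))
      (sw W rho 2) = 0.
    apply: commutator_form_entry => // y g0; have [a a2] := sqrtN1.
    exact: commutator_form_diag2_1mod4 a2 (two_neq0 oddF hg).
  rewrite sw_natural eval_commutator_pull // [X in X - _]lift0 sub0r.
  rewrite (eval_class_mulrn (dc i j)) (eval_class_sum (dc i j)) big1 ?mul0rn ?oppr0 // => l _.
  exact: commutator_torus ne_ij.
Qed.

End DiagonalTorus.

End Main.

Theorem theorem12 (R : realType) (W : SW_theory R)
    (F : finFieldType) (n : nat) (hq : odd #|F|)
    (g : {unit F}) (hg : generator [set: {unit F}] g)
    (z : R[i]) (hz : (#|F|.-1).-primitive_root z)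
    (pi : representation R [set: {'GL_n.+1[F]}]) :
  let t (i : 'I_n.+1) := sw W (torus_repr hg hz i) 2 in
  let a2 := \sum_i t i in
  let v (i : 'I_n.+1) := sw W (sign_char F R i) 1 in
  exists m : nat,
    [/\ m%:R = ((rdegree pi)%:R - \tr (pi (h1 F n))) / 2%:R :> R,
        #|F| = 1 %[mod 4] ->
          ~~ odd m /\
          sw W (res_repr pi (diagGL_group F n)) 2 = a2 *+ m./2
      & #|F| = 3 %[mod 4] ->
          sw W (res_repr pi (signGL_group F n)) 2
            = (\sum_i @cup _ 1 1 2 erefl (v i) (v i)) *+ 'C(m, 2)].
Proof.
move=> t a2 v.
have h1_sqr : (h1 F n ^+ 2 = 1)%g by rewrite (h1E _ hq hg); exact: entryN1_sqr.
have [m [trm _ _]] := sw_involution W pi h1_sqr.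
exists m; split=> [|q1|_].
- have two : 2%:R != 0 :> R by rewrite pnatr_eq0.
  by rewrite trm; field.
- exact: sw2_torus trm q1 _ _.
- exact: (sw2_sign W hq hg trm).
Qed.
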